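(* Let $\tau>0$ and let $f:Y\to X$ be a holomorphic map between hyperbolic surfaces of constant curvature $K_Y=K_X=-\tau/2$. Let $(L',h')\to X$ be a hermitian holomorphic line bundle with a holomorphic section $\phi'$ that satisfies the vortex equation over $X$, $$F_{h'}-\tfrac{\sqrt{-1}}2\big(|\phi'|_{h'}^2-\tau\big)\mathrm{vol}_X=0.$$ Then the triple $(L,h,\phi)$, where $$L:=T^*Y\otimes f^*TX\otimes f^*L',\qquad h:=g_Y^*\cdot f^*g_X\cdot f^*h',\qquad \phi:=df\otimes f^*\phi',$$ satisfies the vortex equation over $Y$, $$F_h-\tfrac{\sqrt{-1}}2\big(|\phi|_h^2-\tau\big)\mathrm{vol}_Y=0.$$
   Context: $X$ and $Y$ are connected Riemann surfaces with Kähler metrics $g_X$, $g_Y$ and area forms $\mathrm{vol}_X$, $\mathrm{vol}_Y$. $TX$, $TY$, $T^*Y$ are the holomorphic (co)tangent line bundles; $g_Y^*$ is the hermitian metric on $T^*Y$ dual to $g_Y$. The derivative $df$ is viewed as a holomorphic section of $T^*Y\otimes f^*TX$, and its norm $|df|$ for $g_Y^*\cdot f^*g_X$ satisfies $f^*\mathrm{vol}_X=|df|^2\,\mathrm{vol}_Y$. $F_h$ denotes the curvature of the Chern connection of $h$. The curvature $K_X$ is normalized so that the Chern curvature of $(TX,g_X)$ is $F_X=-\sqrt{-1}\,K_X\,\mathrm{vol}_X$ (i.e. $K_X$ is the Gaussian curvature), and similarly for $Y$. The vortex equation is $F_h-\sqrt{-1}e^2(|\phi|_h^2-\tau)\,\mathrm{vol}=0$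 with $e^2=\tfrac12$. *)

(* Defs.v *)
From HB Require Import structures.
From mathcomp Require Import all_boot all_order all_algebra.
From mathcomp Require Import complex.
From mathcomp Require Import all_classical all_reals all_analysis.

Set Implicit Arguments.
Unset Strict Implicit.
Unset Printing Implicit Defensive.

Import Order.TTheory GRing.Theory Num.Theory numFieldNormedType.Exports.
Local Open Scope classical_set_scope.
Local Open Scope ring_scope.
Local Open Scope complex_scope.

(* The cast selects the topology induced by the complex modulus, which is not
   inferred from [R[i]] alone. *)
Notation cplx R := (complex R : numFieldType).

Definition sqmod (R : realType) (z : cplx R) : R :=
  complex.Re z ^+ 2 + complex.Im z ^+ 2.

(** * Calculus on open subsets of the complex plane *)

(* With v = 1 and v = 'i these are the real partial derivatives in
   z = x + 'i y. *)
Definition rpartial (R : realType) (v : cplx R) (u : cplx R -> R)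
  (z : cplx R) : R := derive1 (fun t : R => u (z + t%:C * v)) 0.

Definition rpartial_exists (R : realType) (v : cplx R) (u : cplx R -> R)
  (z : cplx R) : Prop := derivable (fun t : R => u (z + t%:C * v)) 0 1.

Fixpoint Ck_on (R : realType) (n : nat) (U : set (cplx R)) (u : cplx R -> R)
  {struct n} : Prop :=
  {in U, continuous u} /\
  if n is m.+1 then
    (forall v, v = 1 \/ v = 'i%C ->
      {in U, forall z, rpartial_exists v u z} /\ Ck_on m U (rpartial v u))
  else True.

Definition smooth_on (R : realType) (U : set (cplx R)) (u : cplx R -> R) :=
  forall n, Ck_on n U u.

Definition cpartial (R : realType) (v : cplx R) (u : cplx R -> cplx R)
  (z : cplx R) : cplx R :=
  Complex (rpartial v (fun w => complex.Re (u w)) z)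
    (rpartial v (fun w => complex.Im (u w)) z).

(* The Wirtinger operators d/dz and d/d(conjugate of z). *)
Definition dz (R : realType) (u : cplx R -> cplx R) (z : cplx R) : cplx R :=
  (cpartial 1 u z - 'i%C * cpartial 'i%C u z) / 2%:R.

Definition dzbar (R : realType) (u : cplx R -> cplx R) (z : cplx R) : cplx R :=
  (cpartial 1 u z + 'i%C * cpartial 'i%C u z) / 2%:R.

Record holomorphic_on (R : realType) (U : set (cplx R))
  (u : cplx R -> cplx R) : Prop := HolomorphicOn {
  hol_Re : smooth_on U (fun z => complex.Re (u z));
  hol_Im : smooth_on U (fun z => complex.Im (u z));
  hol_CR : {in U, forall z, dzbar u z = 0} }.

(* A 1-form P dx + Q dy; a 2-form is given by its coefficient on dx /\ dy. *)
Definition one_form (R : realType) : Type :=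
  ((cplx R -> cplx R) * (cplx R -> cplx R))%type.

Definition ext_d (R : realType) (w : one_form R) (z : cplx R) : cplx R :=
  cpartial 1 w.2 z - cpartial 'i%C w.1 z.

(* k is the squared norm of a holomorphic frame.  The Chern connection form in
   that frame is the unique w of type (1,0) with dk = k (w + conjugate of w),
   namely w = k^-1 (dk/dz) dz, and dz = dx + 'i dy. *)
Definition chern_form (R : realType) (k : cplx R -> R) : one_form R :=
  let A z := dz (fun w => (k w)%:C) z / (k z)%:C in (A, fun z => 'i%C * A z).

Definition chern_curvature (R : realType) (k : cplx R -> R) :
  cplx R -> cplx R := ext_d (chern_form k).

(** * Riemann surfaces *)

Record chart (R : realType) (X : topologicalType) := Chart {
  cdom : set X;
  cimg : set (cplx R);
  zcoord : X -> cplx R;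
  cinv : cplx R -> X;
  cdom_open : open cdom;
  cimg_open : open cimg;
  zcoord_img : {homo zcoord : x / cdom x >-> cimg x};
  cinv_dom : {homo cinv : z / cimg z >-> cdom z};
  zcoordK : {in cdom, cancel zcoord cinv};
  cinvK : {in cimg, cancel cinv zcoord};
  zcoord_continuous : {in cdom, continuous zcoord};
  cinv_continuous : {in cimg, continuous cinv} }.

Definition in_chart (R : realType) (X : topologicalType) (c : chart R X)
  (U : set X) : set (cplx R) := cimg c `&` cinv c @^-1` U.

Record riemannSurface (R : realType) := RiemannSurface {
  rs_space :> topologicalType;
  rs_idx : Type;
  rs_chart : rs_idx -> chart R rs_space;
  rs_hausdorff : hausdorff_space rs_space;
  rs_connected : connected [set: rs_space];
  rs_cover : forall x, exists a, cdom (rs_chart a) x;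
  rs_compat : forall a b,
    holomorphic_on (in_chart (rs_chart b) (cdom (rs_chart a)))
      (zcoord (rs_chart a) \o cinv (rs_chart b)) }.

Definition smooth_fun (R : realType) (X : riemannSurface R) (U : set X)
  (u : X -> R) : Prop :=
  forall a, smooth_on (in_chart (rs_chart a) U) (u \o cinv (rs_chart a)).

Definition holomorphic_fun (R : realType) (X : riemannSurface R) (U : set X)
  (u : X -> cplx R) : Prop :=
  forall a, holomorphic_on (in_chart (rs_chart a) U) (u \o cinv (rs_chart a)).

Definition holomorphic_map (R : realType) (Y X : riemannSurface R)
  (f : Y -> X) : Prop :=
  continuous f /\
  forall a b,
    holomorphic_on (in_chart (rs_chart a) (f @^-1` cdom (rs_chart b)))
      (zcoord (rs_chart b) \o f \o cinv (rs_chart a)).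

(** * Line bundles *)

(* A line bundle is presented by a covering with a frame over each member and
   the transition functions [lb_trans i j], which take the component of a
   vector in frame j to its component in frame i. *)
Record line_bundle (R : realType) (X : Type) := LineBundle {
  lb_idx : Type;
  lb_dom : lb_idx -> set X;
  lb_trans : lb_idx -> lb_idx -> X -> cplx R }.

Record holomorphic_line_bundle (R : realType) (X : riemannSurface R)
  (L : line_bundle R X) : Prop := HolomorphicLineBundle {
  hlb_open : forall i : lb_idx L, open (lb_dom i);
  hlb_cover : forall x, exists i : lb_idx L, lb_dom i x;
  hlb_hol : forall i j : lb_idx L,
    holomorphic_fun (lb_dom i `&` lb_dom j) (lb_trans i j);
  hlb_neq0 : forall (i j : lb_idx L) x, lb_dom i x -> lb_dom j x ->
    lb_trans i j x != 0;
  hlb_id : forall (i : lb_idx L) x, lb_dom i x -> lb_trans i i x = 1;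
  hlb_cocycle : forall (i j k : lb_idx L) x,
    lb_dom i x -> lb_dom j x -> lb_dom k x ->
    lb_trans i j x * lb_trans j k x = lb_trans i k x }.

(* The component of the section in each frame. *)
Definition lsection (R : realType) (X : Type) (L : line_bundle R X) : Type :=
  lb_idx L -> X -> cplx R.

(* The squared norm of each frame. *)
Definition metric (R : realType) (X : Type) (L : line_bundle R X) : Type :=
  lb_idx L -> X -> R.

Record holomorphic_section (R : realType) (X : riemannSurface R)
  (L : line_bundle R X) (s : lsection L) : Prop := HolomorphicSection {
  sec_hol : forall i, holomorphic_fun (lb_dom i) (s i);
  sec_trans : forall i j x, lb_dom i x -> lb_dom j x ->
    s i x = lb_trans i j x * s j x }.

Record hermitian_metric (R : realType) (X : riemannSurface R)
  (L : line_bundle R X) (h : metric L) : Prop := HermitianMetric {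
  met_smooth : forall i, smooth_fun (lb_dom i) (h i);
  met_gt0 : forall i x, lb_dom i x -> 0 < h i x;
  met_trans : forall i j x, lb_dom i x -> lb_dom j x ->
    h j x = sqmod (lb_trans i j x) * h i x }.

Definition sqnorm (R : realType) (X : Type) (L : line_bundle R X)
  (h : metric L) (s : lsection L) (i : lb_idx L) (x : X) : R :=
  sqmod (s i x) * h i x.

Arguments sqnorm {R X L}.

(** ** Operations *)

Definition dual (R : realType) (X : Type) (L : line_bundle R X) :
  line_bundle R X :=
  LineBundle (fun i : lb_idx L => lb_dom i) (fun i j x => (lb_trans i j x)^-1).

Definition tensor (R : realType) (X : Type) (L M : line_bundle R X) :
  line_bundle R X :=
  LineBundle
    (fun p : lb_idx L * lb_idx M => lb_dom p.1 `&` lb_dom p.2)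
    (fun p q x => lb_trans p.1 q.1 x * lb_trans p.2 q.2 x).

Definition pullback (R : realType) (Y X : Type) (f : Y -> X)
  (L : line_bundle R X) : line_bundle R Y :=
  LineBundle (fun i : lb_idx L => f @^-1` lb_dom i)
    (fun i j y => lb_trans i j (f y)).

Definition dual_metric (R : realType) (X : Type) (L : line_bundle R X)
  (h : metric L) : metric (dual L) := fun i x => (h i x)^-1.

Definition tensor_metric (R : realType) (X : Type) (L M : line_bundle R X)
  (h : metric L) (k : metric M) : metric (tensor L M) :=
  fun p x => h p.1 x * k p.2 x.

Definition pullback_metric (R : realType) (Y X : Type) (f : Y -> X)
  (L : line_bundle R X) (h : metric L) : metric (pullback f L) :=
  fun i y => h i (f y).

Definition tensor_section (R : realType) (X : Type) (L M : line_bundle R X)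
  (s : lsection L) (t : lsection M) : lsection (tensor L M) :=
  fun p x => s p.1 x * t p.2 x.

Definition pullback_section (R : realType) (Y X : Type) (f : Y -> X)
  (L : line_bundle R X) (s : lsection L) : lsection (pullback f L) :=
  fun i y => s i (f y).

Arguments pullback_metric {R Y X} f {L}.
Arguments pullback_section {R Y X} f {L}.

(* The frame over the chart a is d/dz_a, so the transition functions are the
   derivatives dz_a/dz_b. *)
Definition tangent (R : realType) (X : riemannSurface R) : line_bundle R X :=
  LineBundle (fun a : rs_idx X => cdom (rs_chart a))
    (fun a b x =>
      dz (zcoord (rs_chart a) \o cinv (rs_chart b)) (zcoord (rs_chart b) x)).

Definition cotangent (R : realType) (X : riemannSurface R) :
  line_bundle R X := dual (tangent X).

(* The component on dz_a (x) d/dw_b, for coordinates z_a on Y and w_b on X. *)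
Definition differential (R : realType) (Y X : riemannSurface R) (f : Y -> X) :
  lsection (tensor (cotangent Y) (pullback f (tangent X))) :=
  fun p y =>
    dz (zcoord (rs_chart p.2) \o f \o cinv (rs_chart p.1))
      (zcoord (rs_chart p.1) y).

Arguments differential {R Y X} f.

(** * Curvature and the vortex equation *)

(* A 2-form on X, as its coefficient on dx /\ dy in each chart. *)
Definition two_form (R : realType) (X : riemannSurface R) : Type :=
  rs_idx X -> X -> cplx R.

(* The curvature form, computed in the frame i. *)
Definition curvature (R : realType) (X : riemannSurface R)
  (L : line_bundle R X) (h : metric L) (i : lb_idx L) : two_form X :=
  fun a x => chern_curvature (h i \o cinv (rs_chart a)) (zcoord (rs_chart a) x).

(* The hermitian metric g on TX is normalized by g(d/dz, d/dz) = |d/dx|^2, so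
   that the area form is g(d/dz, d/dz) ('i / 2) dz /\ (conjugate of dz)
   = g(d/dz, d/dz) dx /\ dy.  In complex dimension one it is automatically
   closed, so every hermitian metric on TX is Kaehler. *)
Definition vol (R : realType) (X : riemannSurface R) (g : metric (tangent X)) :
  two_form X := fun a x => (g a x)%:C.

Definition kahler_metric (R : realType) (X : riemannSurface R)
  (g : metric (tangent X)) : Prop := hermitian_metric g.

Definition is_gauss_curvature (R : realType) (X : riemannSurface R)
  (g : metric (tangent X)) (K : X -> R) : Prop :=
  forall (i : lb_idx (tangent X)) a x, lb_dom i x -> cdom (rs_chart a) x ->
    curvature g i a x = - 'i%C * (K x)%:C * vol g a x.

Definition vortex_equation (R : realType) (X : riemannSurface R)
  (g : metric (tangent X)) (esq tau : R)
  (L : line_bundle R X) (h : metric L) (s : lsection L) : Prop :=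
  forall i a x, lb_dom i x -> cdom (rs_chart a) x ->
    curvature h i a x - 'i%C * esq%:C * (sqnorm h s i x - tau)%:C * vol g a x
      = 0.

Record vortex (R : realType) (X : riemannSurface R)
  (g : metric (tangent X)) (esq tau : R)
  (L : line_bundle R X) (h : metric L) (s : lsection L) : Prop := Vortex {
  vortex_bundle : holomorphic_line_bundle L;
  vortex_metric : hermitian_metric h;
  vortex_section : holomorphic_section s;
  vortex_eq : vortex_equation g esq tau h s }.

(* Main.v *)
(* The Chern curvature of k is 2i times the d-bar derivative of dlog k, so it
   is additive in tensor products, changes sign under duality, and under a
   holomorphic map is pulled back and multiplied by |F'|^2.  Hence
   F_h = - F_Y + f^*F_X + f^*F_{h'}.  The vortex equation for h' and the
   equality of the two curvatures K_X = K_Y = - tau/2 make the constant terms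
   cancel, and f^*vol_X = |df|^2 vol_Y turns the rest into |phi|^2 vol_Y.

   All calculus rests on Caratheodory's form of differentiability (wdiff), for
   which the product, inverse and chain rules are algebraic identities.  The
   mean value theorem supplies it for C^1 functions, and gives the symmetry of
   second derivatives, which makes the derivative of a holomorphic function
   holomorphic. *)

Require Import Defs.
From mathcomp Require Import all_boot all_order all_algebra.
From mathcomp Require Import complex.
From mathcomp Require Import all_classical all_reals all_analysis.
From mathcomp Require Import ring lra.
Import Order.TTheory GRing.Theory Num.Theory.
Import numFieldNormedType.Exports.
Set Implicit Arguments.
Unset Strict Implicit.
Unset Printing Implicit Defensive.
Local Open Scope classical_set_scope.
Local Open Scope ring_scope.
Local Open Scope complex_scope.

(** * The topology of the complex plane *)

(** [smooth_on] speaks only of partial derivatives along 1 and i, and their mere existence gives no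
    chain rule, while every coordinate change and every pullback needs one. Total differentiability
    therefore has to be recovered from the continuity of the partials. Written with the increment
    and its conjugate, it avoids Jacobian matrices, and holomorphy becomes the vanishing of one
    coefficient. No logarithm is ever taken: the quotient (dk/dz)/k has the algebra of d log k. The
    argument concerns metrics and never log |phi|^2, so the zeros of df and phi' need no separate
    treatment. The two curvature hypotheses act differently. The curvature of f^*TX is (i tau/2)
    |df|^2 vol_Y and cancels the -tau inherited from the equation for h'. The dual of TY contributes
    -(i tau/2) vol_Y, which is the constant term of the new equation. *)

Section Topology.
Variable R : realType.
Implicit Types (z w : cplx R).

Lemma norm_ComplexE (a b : R) :
  `|(Complex a b : cplx R)| = (Num.sqrt (a ^+ 2 + b ^+ 2))%:C.
Proof. exact: normc_def. Qed.

(** The norm of [cplx R] is complex-valued, so radii of balls are positive complex numbers, which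
    the order forces to be real. Square boxes replace discs because they separate the two real
    coordinates. *)
Lemma nbhs_cplxP z (P : cplx R -> Prop) :
  (\forall w \near z, P w) <->
  exists2 e : R, 0 < e & forall w,
    `|complex.Re w - complex.Re z| < e ->
    `|complex.Im w - complex.Im z| < e -> P w.
Proof.
split.
- move=> /nbhs_ballP[e /= e0 He].
  have [er er0 eE] : exists2 r : R, 0 < r & e = r%:C.
    exists (complex.Re e); first by move: e0; rewrite ltcE => /andP[].
    by move: e0; rewrite ltcE => /andP[/eqP]; case: (e) => a b /= ->.
  (* A square of half-side er/2 lies in the disc of radius er, since twice (er/2)^2 is less than
     er^2. *)
  exists (er / 2); first by rewrite divr_gt0.
  move=> [a b]; case: z He => c d He /= ha hb; apply: He.
  rewrite /ball /= eE norm_ComplexE ltcR.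
  rewrite -(ger0_norm (ltW er0)) -sqrtr_sqr ltr_sqrt ?exprn_gt0//.
  have h1 : (c - a) ^+ 2 < (er / 2) ^+ 2.
    by rewrite -[ltLHS]real_normK ?num_real// distrC ltrXn2r// ?divr_ge0// ?ltW.
  have h2 : (d - b) ^+ 2 < (er / 2) ^+ 2.
    by rewrite -[ltLHS]real_normK ?num_real// distrC ltrXn2r// ?divr_ge0// ?ltW.
  by nra.
- move=> [e e0 He]; apply/nbhs_ballP; exists e%:C; first by rewrite /= ltcR.
  move=> [a b]; case: z He => c d He; rewrite /ball /= norm_ComplexE ltcR => h.
  have hs (x y : R) : `|x| <= Num.sqrt (x ^+ 2 + y ^+ 2).
    rewrite -sqrtr_sqr ler_wsqrtr// lerDl; exact: sqr_ge0.
  apply: He => /=; rewrite distrC; apply: le_lt_trans h; first exact: hs.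
  by rewrite [X in Num.sqrt X]addrC; exact: hs.
Qed.

Lemma cvg_cplxP (T : Type) (F : set_system T) (FF : Filter F)
    (f : T -> cplx R) (l : cplx R) :
  f @ F --> l <->
  (fun t => complex.Re (f t)) @ F --> complex.Re l /\
  (fun t => complex.Im (f t)) @ F --> complex.Im l.
Proof.
split.
- move=> fl; split; apply/cvgrPdistC_lt => e e0.
  + apply: (fl [set w | `|complex.Re w - complex.Re l| < e]).
    by apply/nbhs_cplxP; exists e.
  + apply: (fl [set w | `|complex.Im w - complex.Im l| < e]).
    by apply/nbhs_cplxP; exists e.
- move=> [/cvgrPdistC_lt h1 /cvgrPdistC_lt h2] A /nbhs_cplxP[e e0 He].
  by apply: filterS2 (h1 _ e0) (h2 _ e0) => t ? ?; exact: He.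
Qed.

Lemma cvg_conjc (T : Type) (F : set_system T) (FF : Filter F)
    (f : T -> cplx R) (l : cplx R) :
  f @ F --> l -> (fun t => (f t)^*%C : cplx R) @ F --> (l^*%C : cplx R).
Proof.
move=> /cvg_cplxP[h1 h2]; apply/cvg_cplxP.
have -> : (fun t => complex.Re (f t)^*%C) = (fun t => complex.Re (f t)).
  by apply/funext => t; case: (f t).
have -> : (fun t => complex.Im (f t)^*%C) = (fun t => - complex.Im (f t)).
  by apply/funext => t; case: (f t).
by case: l h1 h2 => a b /= h1 h2; split=> //; apply: cvgN.
Qed.

Lemma cvg_toC (T : Type) (F : set_system T) (FF : Filter F) (f : T -> R)
    (l : R) :
  f @ F --> l -> (fun t => (f t)%:C : cplx R) @ F --> (l%:C : cplx R).
Proof. by move=> fl; apply/cvg_cplxP; split => //=; exact: cvg_cst. Qed.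

Lemma cvg_line z (v : cplx R) (t0 : R) :
  (fun t : R => (z + t%:C * v : cplx R)) @ t0 --> (z + t0%:C * v : cplx R).
Proof.
apply: cvgD; first exact: cvg_cst.
apply: cvgM; last exact: cvg_cst.
apply/cvg_cplxP; split => /=; first exact: cvg_id.
exact: cvg_cst.
Qed.

End Topology.

(** * Differentiability in Wirtinger form *)

Section Wirtinger.
Variable R : realType.
Implicit Types (z w v : cplx R) (F G : cplx R -> cplx R).

Lemma conjcD z w : (z + w : cplx R)^*%C = (z^*%C : cplx R) + w^*%C.
Proof. exact: rmorphD. Qed.

Lemma conjcM z w : (z * w : cplx R)^*%C = (z^*%C : cplx R) * w^*%C.
Proof. exact: rmorphM. Qed.

(* Caratheodory's form of real differentiability, in Wirtinger notation:
   P and Q are the values of dF/dz and dF/d(conjugate of z) at z. *)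
Definition wdiff F z (P Q : cplx R) := exists p q : cplx R -> cplx R,
  [/\ p @ z --> P, q @ z --> Q &
   \forall w \near z, F w - F z = p w * (w - z) + q w * (w - z)^*%C].

(** The filter [nbhs z] is not punctured, so a limit along it is also the value at z. The
    coefficients p and q of [wdiff] thus take the values P and Q at z. *)
Lemma cvg_nbhs_eq (S : topologicalType) (p : S -> cplx R) (z : S) (l : cplx R) :
  p @ z --> l -> p z = l.
Proof.
move=> pl; apply/esym.
apply: (@norm_hausdorff _ (cplx R)) => A B /pl Az Bz; exists (p z).
split; last exact: nbhs_singleton.
exact: (nbhs_singleton (Az : nbhs z (p @^-1` A))).
Qed.

Lemma wdiff_continuous F z P Q : wdiff F z P Q -> {for z, continuous F}.
Proof.
move=> [p [q [pP qQ E]]]; rewrite /prop_for /continuous_at.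
have wz : (fun w => w - z) @ z --> (0 : cplx R).
  rewrite -[X in _ --> X](subrr z); exact: (cvgB cvg_id (cvg_cst _)).
have h : (fun w => F z + (p w * (w - z) + q w * (w - z)^*%C)) @ z -->
    F z + (P * 0 + Q * (0 : cplx R)^*%C).
  exact: (cvgD (cvg_cst _) (cvgD (cvgM pP wz) (cvgM qQ (cvg_conjc _ wz)))).
rewrite conjc0 !mulr0 !addr0 in h.
have E2 : \forall w \near z, F z + (p w * (w - z) + q w * (w - z)^*%C) = F w.
  by apply: filterS E => w <-; rewrite addrC subrK.
exact: (cvg_trans (near_eq_cvg E2) h).
Qed.

Lemma near_eq_wdiff F G z P Q :
  (\forall w \near z, F w = G w) -> wdiff F z P Q -> wdiff G z P Q.
Proof.
move=> FG [p [q [pP qQ E]]]; exists p, q; split=> //.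
have FGz := nbhs_singleton FG.
by apply: filterS2 FG E => w <- <-; rewrite FGz.
Qed.

Lemma cvg_cst_cplx z c : (fun _ : cplx R => c) @ z --> (c : cplx R).
Proof. exact: (@cvg_cst _ c _ (nbhs z)). Qed.

Lemma near_all z (A : cplx R -> Prop) :
  (forall w, A w) -> \forall w \near z, A w.
Proof. by move=> h; apply: (@filterE _ (nbhs z)). Qed.

Lemma wdiff_cst c z : wdiff (fun=> c) z 0 0.
Proof.
exists (fun=> 0), (fun=> 0); split; [exact: cvg_cst_cplx|exact: cvg_cst_cplx|].
by apply: near_all => w; rewrite !mul0r subrr addr0.
Qed.

Lemma wdiff_id z : wdiff id z 1 0.
Proof.
exists (fun=> 1), (fun=> 0); split; [exact: cvg_cst_cplx|exact: cvg_cst_cplx|].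
by apply: near_all => w; rewrite mul0r mul1r addr0.
Qed.

Lemma wdiffD F G z P Q P' Q' : wdiff F z P Q -> wdiff G z P' Q' ->
  wdiff (fun w => F w + G w) z (P + P') (Q + Q').
Proof.
move=> [p [q [pP qQ E]]] [p' [q' [pP' qQ' E']]].
exists (fun w => p w + p' w), (fun w => q w + q' w).
split; [exact: (cvgD pP pP')|exact: (cvgD qQ qQ')|].
apply: filterS2 E E' => w E E'.
by rewrite opprD addrACA E E' !mulrDl addrACA.
Qed.

Lemma wdiffM F G z P Q P' Q' : wdiff F z P Q -> wdiff G z P' Q' ->
  wdiff (fun w => F w * G w) z (P * G z + F z * P') (Q * G z + F z * Q').
Proof.
move=> dF dG; have Gz := wdiff_continuous dG.
move: dF dG => [p [q [pP qQ E]]] [p' [q' [pP' qQ' E']]].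
exists (fun w => p w * G w + F z * p' w), (fun w => q w * G w + F z * q' w).
split.
- exact: (cvgD (cvgM pP Gz) (cvgM (cvg_cst _) pP')).
- exact: (cvgD (cvgM qQ Gz) (cvgM (cvg_cst _) qQ')).
apply: filterS2 E E' => w E E'.
have -> : F w * G w - F z * G z = (F w - F z) * G w + F z * (G w - G z).
  by ring.
by rewrite E E'; ring.
Qed.

Lemma wdiffV F z P Q : F z != 0 -> wdiff F z P Q ->
  wdiff (fun w => (F w)^-1) z (- P / F z ^+ 2) (- Q / F z ^+ 2).
Proof.
move=> Fz0 dF; have Fc := wdiff_continuous dF.
move: dF => [p [q [pP qQ E]]].
exists (fun w => - p w / (F w * F z)), (fun w => - q w / (F w * F z)).
have FF : (fun w => (F w * F z)^-1) @ z --> (F z ^+ 2)^-1.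
  have FF0 : F z * F z != 0 by rewrite mulf_neq0.
  by rewrite expr2; exact: (cvgV FF0 (cvgM Fc (cvg_cst _))).
split; [exact: (cvgM (cvgN pP) FF)|exact: (cvgM (cvgN qQ) FF)|].
have Fn0 : \forall w \near z, F w != 0.
  exact: (cvgr_neq0 _ Fc Fz0).
apply: filterS2 Fn0 E => w Fw0 E.
have -> : (F w)^-1 - (F z)^-1 = - (F w - F z) / (F w * F z).
  by field; apply/andP.
by rewrite E; ring.
Qed.

(** The conjugate of the increment of F also enters, and conjugation exchanges the (w - z) part with
    the conjugate part. This is where the terms in Q^* and P^* come from. *)
Lemma wdiff_comp F G z P Q P' Q' : wdiff F z P Q -> wdiff G (F z) P' Q' ->
  wdiff (G \o F) z (P' * P + Q' * Q^*%C) (P' * Q + Q' * P^*%C).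
Proof.
move=> dF; have Fc := wdiff_continuous dF.
move: dF => [p [q [pP qQ E]]] [p' [q' [pP' qQ' E']]].
exists (fun w => p' (F w) * p w + q' (F w) * (q w)^*%C),
       (fun w => p' (F w) * q w + q' (F w) * (p w)^*%C).
have pF : p' \o F @ z --> P' by exact: (cvg_comp _ _ Fc pP').
have qF : q' \o F @ z --> Q' by exact: (cvg_comp _ _ Fc qQ').
split.
- exact: (cvgD (cvgM pF pP) (cvgM qF (cvg_conjc _ qQ))).
- exact: (cvgD (cvgM pF qQ) (cvgM qF (cvg_conjc _ pP))).
have E'' : \forall w \near z, G (F w) - G (F z) =
    p' (F w) * (F w - F z) + q' (F w) * (F w - F z)^*%C by exact: (Fc _ E').
apply: filterS2 E E'' => w E /= ->; rewrite E.
move: (w - z) => d; rewrite conjcD !conjcM conjcK; ring.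
Qed.

(** For real t the increment t v and its conjugate share the factor t, so p v + q v^* along the line
    is itself a Caratheodory slope in one real variable. *)
Lemma wdiff_is_derive_ReIm F z P Q v : wdiff F z P Q ->
  is_derive (0 : R) 1 (fun t : R => complex.Re (F (z + t%:C * v)))
    (complex.Re (P * v + Q * v^*%C)) /\
  is_derive (0 : R) 1 (fun t : R => complex.Im (F (z + t%:C * v)))
    (complex.Im (P * v + Q * v^*%C)).
Proof.
move=> [p [q [pP qQ E]]].
have l0 := @cvg_line R z v 0.
have z0 : z + (0 : R)%:C * v = z by rewrite mul0r addr0.
rewrite z0 in l0.
pose g (t : R) : cplx R := p (z + t%:C * v) * v + q (z + t%:C * v) * v^*%C.
have gl : g @ (0 : R) --> P * v + Q * v^*%C.
  exact: (cvgD (cvgM (cvg_comp _ _ l0 pP) (cvg_cst _))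
               (cvgM (cvg_comp _ _ l0 qQ) (cvg_cst _))).
have g0 := cvg_nbhs_eq gl.
have Et : \forall t \near (0 : R), F (z + t%:C * v) = F z + t%:C * g t.
  have Et0 : \forall t \near (0 : R), F (z + t%:C * v) - F z =
      p (z + t%:C * v) * (z + t%:C * v - z) +
      q (z + t%:C * v) * (z + t%:C * v - z)^*%C by exact: (l0 _ E).
  apply: filterS Et0 => t /= Et.
  have -> : F (z + t%:C * v) = F z + (F (z + t%:C * v) - F z) by ring.
  rewrite Et addrAC subrr add0r conjcM conjc_real /g.
  by ring.
have ReM (t : R) (x : cplx R) : complex.Re (t%:C * x) = t * complex.Re x.
  by case: x => a b /=; rewrite mul0r subr0.
have ImM (t : R) (x : cplx R) : complex.Im (t%:C * x) = t * complex.Im x.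
  by case: x => a b /=; rewrite mul0r addr0.
move/cvg_cplxP : (gl) => [gr gi]; split.
- apply: (@near_eq_is_derive _ _ _ (fun t : R =>
    complex.Re (F z) + t * complex.Re (g t))).
    apply: filterS Et => t ->.
    by rewrite -(ReM t (g t)); case: (F z) (_ * g t) => ? ? [].
  apply/is_derive1_caratheodory; exists (fun t => complex.Re (g t)); split.
  + by move=> t; rewrite mul0r addr0 subr0 addrAC subrr add0r mulrC.
  + by rewrite /prop_for /continuous_at g0.
  + by rewrite g0.
- apply: (@near_eq_is_derive _ _ _ (fun t : R =>
    complex.Im (F z) + t * complex.Im (g t))).
    apply: filterS Et => t ->.
    by rewrite -(ImM t (g t)); case: (F z) (_ * g t) => ? ? [].
  apply/is_derive1_caratheodory; exists (fun t => complex.Im (g t)); split.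
  + by move=> t; rewrite mul0r addr0 subr0 addrAC subrr add0r mulrC.
  + by rewrite /prop_for /continuous_at g0.
  + by rewrite g0.
Qed.

Lemma wdiff_cpartial F z P Q v : wdiff F z P Q ->
  cpartial v F z = P * v + Q * v^*%C.
Proof.
move=> /(@wdiff_is_derive_ReIm _ _ _ _ v)[h1 h2].
rewrite /cpartial /rpartial !derive1E !derive_val.
by case: (_ + _).
Qed.

Lemma wdiff_dz F z P Q : wdiff F z P Q -> dz F z = P.
Proof.
move=> h; rewrite /dz !(wdiff_cpartial _ h) conjc1.
have -> : ('i%C : cplx R)^*%C = - 'i%C by rewrite /= ; congr Complex; ring.
have := sqr_i R; rewrite expr2.
(* From here on only i * i = -1 matters, so 'i becomes an atom for [field]. *)
move: (Complex 0 1 : cplx R) => i ii.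
rewrite !mulr1 !mulrDr !mulrN !mulrA ![i * _ * i]mulrAC ii.
by field.
Qed.

Lemma wdiff_dzbar F z P Q : wdiff F z P Q -> dzbar F z = Q.
Proof.
move=> h; rewrite /dzbar !(wdiff_cpartial _ h) conjc1.
have -> : ('i%C : cplx R)^*%C = - 'i%C by rewrite /= ; congr Complex; ring.
have := sqr_i R; rewrite expr2.
move: (Complex 0 1 : cplx R) => i ii.
rewrite !mulr1 !mulrDr !mulrN !mulrA ![i * _ * i]mulrAC ii.
by field.
Qed.

Definition wdiffable F z := exists P Q, wdiff F z P Q.

Lemma wdiffableP F z : wdiffable F z -> wdiff F z (dz F z) (dzbar F z).
Proof. by move=> [P [Q h]]; rewrite (wdiff_dz h) (wdiff_dzbar h). Qed.

End Wirtinger.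

(** * Real partial derivatives *)

Section RealPartials.
Variable R : realType.
Implicit Types (z w v : cplx R) (u : cplx R -> R) (U V : set (cplx R)).

Lemma Re_line z v (t : R) :
  complex.Re (z + t%:C * v) = complex.Re z + t * complex.Re v.
Proof. by case: z v => ? ? [? ?] /=; ring. Qed.

Lemma Im_line z v (t : R) :
  complex.Im (z + t%:C * v) = complex.Im z + t * complex.Im v.
Proof. by case: z v => ? ? [? ?] /=; ring. Qed.

Lemma open_box U z : open U -> U z -> exists2 e : R, 0 < e &
  forall w, `|complex.Re w - complex.Re z| < e ->
    `|complex.Im w - complex.Im z| < e -> U w.
Proof. by move=> oU Uz; apply/nbhs_cplxP; exact: open_nbhs_nbhs. Qed.

Lemma near_line U z v : open U -> U z ->
  \forall t \near (0 : R), U (z + t%:C * v).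
Proof.
move=> oU Uz; have nU : nbhs z U by exact: open_nbhs_nbhs.
have := @cvg_line R z v 0; rewrite mul0r addr0 => h.
exact: (h _ nU).
Qed.

(** [rpartial] differentiates at parameter 0 only. Taking z + t0 v as base point and composing with
    t - t0 moves this to an arbitrary parameter, as the mean value theorem requires. *)
Lemma is_derive_line u z v (t0 : R) :
  rpartial_exists v u (z + t0%:C * v) ->
  is_derive t0 1 (fun t => u (z + t%:C * v)) (rpartial v u (z + t0%:C * v)).
Proof.
move=> h.
have d0 : is_derive (t0 - t0) 1 (fun t => u (z + t0%:C * v + t%:C * v))
    (rpartial v u (z + t0%:C * v)).
  by rewrite subrr /rpartial derive1E; apply/derivableP.
have d1 : is_derive t0 1 (fun t : R => t - t0) 1.
  by apply: is_derive_eq; rewrite ?subr0 ?addr0 ?oppr0.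
have := @is_derive1_comp _ (fun t => u (z + t0%:C * v + t%:C * v))
  (fun t : R => t - t0) t0 _ _ d0 d1.
rewrite mulr1; congr is_derive; apply/funext => t /=; congr (u _).
by rewrite -addrA rmorphB; congr (_ + _); ring.
Qed.

(** The increment s may have either sign. The bound |c| <= |s| is the form in which intermediate
    points are later squeezed towards the base point. *)
Lemma MVT0 (phi dphi : R -> R) (s : R) :
  (forall t : R, `|t| <= `|s| -> is_derive t 1 phi (dphi t)) ->
  exists2 c, `|c| <= `|s| & phi s - phi 0 = dphi c * s.
Proof.
move=> h; have [s0|s0] := leP 0 s.
- have h1 x : x \in `]0, s[ -> is_derive x 1 phi (dphi x).
    rewrite in_itv /= => /andP[x0 xs]; apply: h.
    by rewrite !ger0_norm// ltW.
  have [|c] := @MVT_segment R phi dphi 0 s s0 h1.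
    apply: derivable_within_continuous => x; rewrite in_itv /= => /andP[x0 xs].
    by apply: ex_derive; apply: h; rewrite !ger0_norm.
  rewrite in_itv /= subr0 => /andP[c0 cs] E; exists c => //.
  by rewrite !ger0_norm.
- have h1 x : x \in `]s, 0[ -> is_derive x 1 phi (dphi x).
    rewrite in_itv /= => /andP[x0 xs]; apply: h.
    by rewrite !ltr0_norm// lerN2 ltW.
  have [|c] := @MVT_segment R phi dphi s 0 (ltW s0) h1.
    apply: derivable_within_continuous => x; rewrite in_itv /= => /andP[x0 xs].
    by apply: ex_derive; apply: h; rewrite !ler0_norm// ?lerN2// ltW.
  rewrite in_itv /= sub0r => /andP[c0 cs] E; exists c.
    by rewrite !ler0_norm// ?lerN2// ltW.
  by rewrite -opprB E mulrN opprK.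
Qed.

Lemma MVT_line u z v (s : R) :
  (forall t, `|t| <= `|s| -> rpartial_exists v u (z + t%:C * v)) ->
  exists2 c, `|c| <= `|s| &
    u (z + s%:C * v) - u z = rpartial v u (z + c%:C * v) * s.
Proof.
move=> h; have [t ts|c cs E] := @MVT0 (fun t => u (z + t%:C * v))
  (fun t => rpartial v u (z + t%:C * v)) s.
  by apply: is_derive_line; exact: h.
by exists c => //; rewrite -E mul0r addr0.
Qed.

(** Go from z to w by a vertical step to the corner [z1], then a horizontal one. The mean value
    theorem on each step expresses the increment by partials at two intermediate points. In each
    coordinate these are no further from z than w is, so they tend to z, and continuity of the
    partials at z makes the coefficients converge. *)
Lemma C1_wdiff U u z : open U -> U z ->
  {in U, forall w, rpartial_exists 1 u w} ->
  {in U, forall w, rpartial_exists 'i%C u w} ->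
  {for z, continuous (rpartial 1 u)} ->
  {for z, continuous (rpartial 'i%C u)} ->
  wdiff (fun w => (u w)%:C) z
    (((rpartial 1 u z)%:C - 'i%C * (rpartial 'i%C u z)%:C) / 2)
    (((rpartial 1 u z)%:C + 'i%C * (rpartial 'i%C u z)%:C) / 2).
Proof.
move=> oU Uz ex ey cx cy.
have [e e0 He] := open_box oU Uz.
(* The properties are conditional on w lying in the box. Outside it (z, z) serves as a default, so
   that [choice] yields functions on the whole plane. *)
have key w : exists xe : cplx R * cplx R,
    `|complex.Re w - complex.Re z| < e ->
    `|complex.Im w - complex.Im z| < e ->
    [/\ `|complex.Re xe.1 - complex.Re z| <= `|complex.Re w - complex.Re z|,
        `|complex.Im xe.1 - complex.Im z| <= `|complex.Im w - complex.Im z|,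
        `|complex.Re xe.2 - complex.Re z| <= `|complex.Re w - complex.Re z|,
        `|complex.Im xe.2 - complex.Im z| <= `|complex.Im w - complex.Im z| &
        u w - u z = rpartial 1 u xe.1 * (complex.Re w - complex.Re z)
           + rpartial 'i%C u xe.2 * (complex.Im w - complex.Im z)].
  have [[hr hi]|] := pselect (`|complex.Re w - complex.Re z| < e /\
                           `|complex.Im w - complex.Im z| < e); last first.
    by move=> h; exists (z, z) => ? ?; exfalso; exact: h.
  pose a := complex.Re w - complex.Re z; pose b := complex.Im w - complex.Im z.
  pose z1 : cplx R := Complex (complex.Re z) (complex.Im w).
  have [t ta|c ca Ec] := @MVT_line u z1 1 a.
    apply: ex; rewrite inE; apply: He; rewrite ?Re_line ?Im_line /=.
    - by rewrite mulr1 addrAC subrr add0r; exact: le_lt_trans ta hr.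
    - by rewrite mulr0 addr0.
  have [t tb|d db Ed] := @MVT_line u z 'i%C b.
    apply: ey; rewrite inE; apply: He; rewrite ?Re_line ?Im_line /=.
    - by rewrite mulr0 addr0 subrr normr0.
    - by rewrite mulr1 addrAC subrr add0r; exact: le_lt_trans tb hi.
  exists (z1 + c%:C * 1, z + d%:C * 'i%C) => _ _ /=.
  rewrite !Re_line !Im_line /= !mulr1 !mulr0 !addr0 ![_ + _ - _]addrAC !subrr.
  rewrite !add0r !subr0 !normr0; split=> //.
  - have z1E : z + b%:C * 'i%C = z1.
      rewrite /z1 /b; case: (z) (w) => ? ? [? ?] /=; apply/eqP.
      by rewrite eq_complex /=; apply/andP; split; apply/eqP; ring.
    have wE : z1 + a%:C = w.
      rewrite /z1 /a; case: (z) (w) => ? ? [? ?] /=; apply/eqP.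
      by rewrite eq_complex /=; apply/andP; split; apply/eqP; ring.
    by rewrite !mulr1 in Ec; rewrite -Ec -Ed z1E wE; ring.
have [xe Hxe] := choice key.
have near_e : \forall w \near z, `|complex.Re w - complex.Re z| < e /\
    `|complex.Im w - complex.Im z| < e.
  by apply/nbhs_cplxP; exists e.
have c1 : (fun w => (xe w).1) @ z --> z.
  move=> A /nbhs_cplxP[r r0 Hr].
  suff nA : \forall w \near z, A (xe w).1 by exact: nA.
  apply/nbhs_cplxP.
  (* The bound r puts the intermediate point in A; the bound e makes [Hxe] applicable. *)
  exists (Num.min r e).
    by rewrite lt_min r0 e0.
  move=> w; rewrite !lt_min => /andP[h1 h2] /andP[h3 h4].
  have [k1 k2 _ _ _] := Hxe w h2 h4.
  by apply: Hr; [exact: le_lt_trans k1 h1|exact: le_lt_trans k2 h3].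
have c2 : (fun w => (xe w).2) @ z --> z.
  move=> A /nbhs_cplxP[r r0 Hr].
  suff nA : \forall w \near z, A (xe w).2 by exact: nA.
  apply/nbhs_cplxP.
  exists (Num.min r e).
    by rewrite lt_min r0 e0.
  move=> w; rewrite !lt_min => /andP[h1 h2] /andP[h3 h4].
  have [_ _ k1 k2 _] := Hxe w h2 h4.
  by apply: Hr; [exact: le_lt_trans k1 h1|exact: le_lt_trans k2 h3].
have cx1 := cvg_toC (nbhs_filter z) (cvg_comp _ _ c1 cx).
have cy1 := cvg_toC (nbhs_filter z) (cvg_comp _ _ c2 cy).
exists (fun w => ((rpartial 1 u (xe w).1)%:C
                    - 'i%C * (rpartial 'i%C u (xe w).2)%:C) / 2),
       (fun w => ((rpartial 1 u (xe w).1)%:C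
                    + 'i%C * (rpartial 'i%C u (xe w).2)%:C) / 2).
split.
- exact: (cvgM (cvgB cx1 (cvgM (cvg_cst _) cy1)) (cvg_cst _)).
- exact: (cvgM (cvgD cx1 (cvgM (cvg_cst _) cy1)) (cvg_cst _)).
apply: filterS near_e => w [h1 h2]; have [_ _ _ _ E] := Hxe w h1 h2.
have -> : (u w)%:C - (u z)%:C = (rpartial 1 u (xe w).1)%:C *
    (complex.Re w - complex.Re z)%:C + (rpartial 'i%C u (xe w).2)%:C *
    (complex.Im w - complex.Im z)%:C :> cplx R.
  by rewrite -rmorphB E rmorphD !rmorphM.
have -> : w - z = (complex.Re w - complex.Re z)%:C
    + 'i%C * (complex.Im w - complex.Im z)%:C.
  by rewrite {1}(complexE w) {1}(complexE z) !rmorphB /=; ring.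
rewrite conjcD conjcM !conjc_real.
set A := (rpartial 1 u (xe w).1)%:C; set B := (rpartial 'i%C u (xe w).2)%:C.
have -> : ('i%C : cplx R)^*%C = - 'i%C by rewrite /= ; congr Complex; ring.
have := sqr_i R; rewrite expr2.
move: (Complex 0 1 : cplx R) => i ii.
move: (complex.Re w - complex.Re z)%:C (complex.Im w - complex.Im z)%:C => a b.
have -> : (A - i * B) / 2 * (a + i * b) + (A + i * B) / 2 * (a + - i * b) =
  A * a - (i * i) * B * b by field.
by rewrite ii; ring.
Qed.

(** The mean value theorem is used along v for [phi], the increment of u in the direction w, and
    then along w for the partial of u along v. The second difference is symmetric in v and w, so
    exchanging them yields the other mixed partial. *)
Lemma second_difference u z v w (h : R) :
  (forall s t, `|s| <= `|h| -> `|t| <= `|h| ->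
    rpartial_exists v u (z + s%:C * v + t%:C * w) /\
    rpartial_exists w (rpartial v u) (z + s%:C * v + t%:C * w)) ->
  exists s t, [/\ `|s| <= `|h|, `|t| <= `|h| &
    u (z + h%:C * v + h%:C * w) - u (z + h%:C * v) - u (z + h%:C * w) + u z
    = rpartial w (rpartial v u) (z + s%:C * v + t%:C * w) * h * h].
Proof.
move=> ex.
pose phi (t : R) := u (z + h%:C * w + t%:C * v) - u (z + t%:C * v).
have [t th|s sh Es] := @MVT0 phi (fun t =>
  rpartial v u (z + h%:C * w + t%:C * v) - rpartial v u (z + t%:C * v)) h.
  apply: is_deriveB; apply: is_derive_line.
    by rewrite addrAC; apply: (ex t h _ _).1.
  have := (ex t 0 th _).1; rewrite mul0r addr0; apply.
  by rewrite normr0.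
have [t th|t th Et] := @MVT_line (rpartial v u) (z + s%:C * v) w h.
  exact: (ex s t sh th).2.
exists s, t; split=> //.
rewrite -Et [z + s%:C * v + _]addrAC -Es /phi mul0r !addr0.
by rewrite [z + h%:C * v + _]addrAC; ring.
Qed.

Lemma dist_le_half (a b m e : R) :
  `|a - m| < e / 2 -> `|b - m| < e / 2 -> `|a - b| <= e.
Proof.
move=> am bm; rewrite -(subrKA m) (splitr e) ltW//.
by apply: le_lt_trans (ler_normD _ _) _; rewrite [`|m - b|]distrC ltrD.
Qed.

(** One second difference equals h^2 times either mixed partial, each at its own point near z. The
    two values coincide, and each is within eps/2 of the corresponding mixed partial at z. *)
Lemma Schwarz U u z : open U -> U z ->
  {in U, forall w, rpartial_exists 1 u w} ->
  {in U, forall w, rpartial_exists 'i%C u w} ->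
  {in U, forall w, rpartial_exists 'i%C (rpartial 1 u) w} ->
  {in U, forall w, rpartial_exists 1 (rpartial 'i%C u) w} ->
  {for z, continuous (rpartial 'i%C (rpartial 1 u))} ->
  {for z, continuous (rpartial 1 (rpartial 'i%C u))} ->
  rpartial 'i%C (rpartial 1 u) z = rpartial 1 (rpartial 'i%C u) z.
Proof.
move=> oU Uz e1 ei e1i ei1 c1 c2.
have [e e0 He] := open_box oU Uz.
apply/eqP; rewrite -subr_eq0 -normr_le0; apply/ler_addgt0Pl => eps eps0.
rewrite addr0.
have eps20 : 0 < eps / 2 by rewrite divr_gt0.
move/cvgrPdist_lt : c1 => /(_ _ eps20) /nbhs_cplxP[r1 r10 H1].
move/cvgrPdist_lt : c2 => /(_ _ eps20) /nbhs_cplxP[r2 r20 H2].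
(* Halving makes the inequality strict, so points at coordinate distance at most h lie inside U and
   inside both continuity boxes. *)
pose h := Num.min e (Num.min r1 r2) / 2.
have m0 : 0 < Num.min e (Num.min r1 r2) by rewrite !lt_min e0 r10 r20.
have h0 : 0 < h by rewrite divr_gt0.
have hm : h < Num.min e (Num.min r1 r2).
  by rewrite /h ltr_pdivrMr// ltr_pMr// ltr1n.
move: (hm); rewrite !lt_min => /and3P[he h1 h2].
have rE (s t : R) : complex.Re (z + s%:C * 1 + t%:C * 'i%C) - complex.Re z = s.
  by rewrite !(Re_line, Im_line) /=; ring.
have iE (s t : R) : complex.Im (z + s%:C * 1 + t%:C * 'i%C) - complex.Im z = t.
  by rewrite !(Re_line, Im_line) /=; ring.
have hE : `|h| = h by exact: gtr0_norm.
have [|s [t [sh th E1]]] := @second_difference u z 1 'i%C h.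
  move=> s t; rewrite hE => sh th.
  have Ut : U (z + s%:C * 1 + t%:C * 'i%C).
    by apply: He; rewrite ?rE ?iE; apply: le_lt_trans he.
  by split; [apply: e1|apply: e1i]; rewrite inE.
have [|s' [t' [sh' th' E2]]] := @second_difference u z 'i%C 1 h.
  move=> s' t'; rewrite hE => sh' th'.
  have Ut : U (z + s'%:C * 'i%C + t'%:C * 1).
    by rewrite addrAC; apply: He; rewrite ?rE ?iE; apply: le_lt_trans he.
  by split; [apply: ei|apply: ei1]; rewrite inE.
rewrite hE in sh th sh' th'.
(* Both sides times h * h are the same second difference, up to the order of its two middle terms; h
   is cancelled twice. *)
have E : rpartial 'i%C (rpartial 1 u) (z + s%:C * 1 + t%:C * 'i%C) =
         rpartial 1 (rpartial 'i%C u) (z + t'%:C * 1 + s'%:C * 'i%C).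
  apply: (mulIf (lt0r_neq0 h0)); apply: (mulIf (lt0r_neq0 h0)).
  have swap (p q c1 c2 c3 c4 : R) : c1 - c2 - c3 + c4 = p ->
      c1 - c3 - c2 + c4 = q -> p = q by move=> <- <-; ring.
  rewrite [z + h%:C * 'i%C + _]addrAC in E2.
  by rewrite [z + t'%:C * 1 + _]addrAC; exact: swap E1 E2.
have {}H1 := H1 (z + s%:C * 1 + t%:C * 'i%C).
have {}H2 := H2 (z + t'%:C * 1 + s'%:C * 'i%C).
rewrite rE iE in H1; rewrite rE iE in H2.
have {}H1 := H1 (le_lt_trans sh h1) (le_lt_trans th h1).
have {}H2 := H2 (le_lt_trans th' h2) (le_lt_trans sh' h2).
by rewrite E in H1; exact: dist_le_half H1 H2.
Qed.

End RealPartials.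

(** * Functions of class C^k *)

Section Smooth.
Variable R : realType.
Implicit Types (z w v : cplx R) (u : cplx R -> R) (U V : set (cplx R))
  (F G : cplx R -> cplx R).

Lemma Ck_on_continuous n U u : Ck_on n U u -> {in U, continuous u}.
Proof. by case: n => [|n] []. Qed.

Lemma Ck_on_rpartial_exists n U u v : Ck_on n.+1 U u -> v = 1 \/ v = 'i%C ->
  {in U, forall z, rpartial_exists v u z}.
Proof. by move=> [_ h] /h[]. Qed.

Lemma Ck_on_rpartial n U u v : Ck_on n.+1 U u -> v = 1 \/ v = 'i%C ->
  Ck_on n U (rpartial v u).
Proof. by move=> [_ h] /h[]. Qed.

Lemma Ck_onW n U u : Ck_on n.+1 U u -> Ck_on n U u.
Proof.
elim: n u => [|n IH] u [cu hu]; first by split.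
by split=> // v /hu[ev cv]; split=> //; exact: IH.
Qed.

(** Each clause of [Ck_on] is a condition at single points with limits taken in the whole plane, so
    it may be checked point by point. *)
Lemma Ck_on_local n U u :
  (forall z, U z -> exists2 V, V z & Ck_on n V u) -> Ck_on n U u.
Proof.
elim: n u => [|n IH] u h.
- split=> // z; rewrite inE => Uz; have [V Vz [cu _]] := h z Uz.
  by apply: cu; rewrite inE.
- split.
    move=> z; rewrite inE => Uz; have [V Vz [cu _]] := h z Uz.
    by apply: cu; rewrite inE.
  move=> v dv; split.
    move=> z; rewrite inE => Uz; have [V Vz [_ hu]] := h z Uz.
    by have [eu _] := hu v dv; apply: eu; rewrite inE.
  apply: IH => z Uz; have [V Vz [_ hu]] := h z Uz; exists V => //.
  by have [] := hu v dv.
Qed.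

Lemma Ck_on_sub n U V u : V `<=` U -> Ck_on n U u -> Ck_on n V u.
Proof.
elim: n u => [|n IH] u VU [cu hu].
  by split=> // z; rewrite inE => /VU Uz; apply: cu; rewrite inE.
split; first by move=> z; rewrite inE => /VU Uz; apply: cu; rewrite inE.
move=> v /hu[eu su]; split; last exact: IH.
by move=> z; rewrite inE => /VU Uz; apply: eu; rewrite inE.
Qed.

Lemma near_line_eq U u u' z v : open U -> U z ->
  (forall w, U w -> u w = u' w) ->
  \forall t \near (0 : R), u (z + t%:C * v) = u' (z + t%:C * v).
Proof. by move=> oU Uz E; apply: filterS (near_line v oU Uz) => t /E. Qed.

Lemma eq_rpartial U u u' z v : open U -> U z -> (forall w, U w -> u w = u' w) ->
  rpartial v u z = rpartial v u' z.
Proof.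
move=> oU Uz E; rewrite /rpartial !derive1E; apply: near_eq_derive.
exact: near_line_eq oU Uz E.
Qed.

Lemma eq_rpartial_exists U u u' z v : open U -> U z ->
  (forall w, U w -> u w = u' w) ->
  rpartial_exists v u z -> rpartial_exists v u' z.
Proof.
move=> oU Uz E; apply: near_eq_derivable.
exact: near_line_eq oU Uz E.
Qed.

Lemma eq_dz U F G z : open U -> U z -> (forall w, U w -> F w = G w) ->
  dz F z = dz G z.
Proof.
move=> oU Uz E; rewrite /dz /cpartial.
have Er w : U w -> complex.Re (F w) = complex.Re (G w) by move=> /E ->.
have Ei w : U w -> complex.Im (F w) = complex.Im (G w) by move=> /E ->.
by rewrite !(eq_rpartial _ oU Uz Er) !(eq_rpartial _ oU Uz Ei).
Qed.

Lemma eq_dzbar U F G z : open U -> U z -> (forall w, U w -> F w = G w) ->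
  dzbar F z = dzbar G z.
Proof.
move=> oU Uz E; rewrite /dzbar /cpartial.
have Er w : U w -> complex.Re (F w) = complex.Re (G w) by move=> /E ->.
have Ei w : U w -> complex.Im (F w) = complex.Im (G w) by move=> /E ->.
by rewrite !(eq_rpartial _ oU Uz Er) !(eq_rpartial _ oU Uz Ei).
Qed.

Lemma continuous_eq_on U u u' z : open U -> U z ->
  (forall w, U w -> u w = u' w) -> {for z, continuous u} ->
  {for z, continuous u'}.
Proof.
move=> oU Uz E cu; rewrite /prop_for /continuous_at -(E z Uz).
have nE : \forall w \near z, u w = u' w.
  by apply: filterS (open_nbhs_nbhs (conj oU Uz)) => w /E.
exact: (cvg_trans (near_eq_cvg nE) cu).
Qed.

Lemma eq_Ck_on n U u u' : open U -> (forall w, U w -> u w = u' w) ->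
  Ck_on n U u -> Ck_on n U u'.
Proof.
move=> oU; elim: n u u' => [|n IH] u u' E [cu hu].
  split=> // z; rewrite inE => Uz; apply: (continuous_eq_on oU Uz E).
  by apply: cu; rewrite inE.
split.
  move=> z; rewrite inE => Uz; apply: (continuous_eq_on oU Uz E).
  by apply: cu; rewrite inE.
move=> v /hu[eu su]; split.
  move=> z; rewrite inE => Uz; apply: (eq_rpartial_exists oU Uz E).
  by apply: eu; rewrite inE.
by apply: IH su => w Uw; exact: (eq_rpartial v oU Uw E).
Qed.

Lemma Ck_on_cst n U (c : R) : Ck_on n U (fun=> c).
Proof.
elim: n c => [|n IH] c.
  by split=> // z _; exact: (@cvg_cst _ c _ (nbhs z)).
split; first by move=> z _; exact: (@cvg_cst _ c _ (nbhs z)).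
move=> v _; split; first by move=> z _; exact: derivable_cst.
have -> : rpartial v (fun=> c) = (fun=> 0).
  by apply/funext => z; rewrite /rpartial derive1_cst.
exact: IH.
Qed.

Lemma Ck_onD n U u u' : Ck_on n U u -> Ck_on n U u' ->
  open U -> Ck_on n U (fun z => u z + u' z).
Proof.
move=> + + oU; elim: n u u' => [|n IH] u u' [cu hu] [cu' hu'].
  by split=> // z Uz; exact: (cvgD (cu z Uz) (cu' z Uz)).
split; first by move=> z Uz; exact: (cvgD (cu z Uz) (cu' z Uz)).
move=> v dv; have [eu su] := hu v dv; have [eu' su'] := hu' v dv; split.
  by move=> z Uz; exact: (derivableD (eu z Uz) (eu' z Uz)).
apply: eq_Ck_on oU _ (IH _ _ su su') => z Uz.
have Uz' : z \in U by rewrite inE.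
rewrite /rpartial !derive1E; apply/esym.
exact: (deriveD (eu z Uz') (eu' z Uz')).
Qed.

Lemma Ck_onM n U u u' : Ck_on n U u -> Ck_on n U u' ->
  open U -> Ck_on n U (fun z => u z * u' z).
Proof.
move=> + + oU; elim: n u u' => [|n IH] u u' su su'.
  move: su su' => [cu _] [cu' _].
  by split=> // z Uz; exact: (cvgM (cu z Uz) (cu' z Uz)).
(* Each Leibniz term pairs a partial with an undifferentiated factor, whose class is lowered to n to
   match the induction hypothesis. *)
have wu := Ck_onW su; have wu' := Ck_onW su'.
move: su su' => [cu hu] [cu' hu'].
split; first by move=> z Uz; exact: (cvgM (cu z Uz) (cu' z Uz)).
move=> v dv; have [eu su] := hu v dv; have [eu' su'] := hu' v dv; split.
  by move=> z Uz; exact: (derivableM (eu z Uz) (eu' z Uz)).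
apply: eq_Ck_on oU _ (Ck_onD (IH _ _ wu su') (IH _ _ wu' su) oU) => z Uz.
have Uz' : z \in U by rewrite inE.
rewrite /rpartial !derive1E; apply/esym.
have := deriveM (eu z Uz') (eu' z Uz'); rewrite !mul0r !addr0.
by rewrite /GRing.scale /=; apply.
Qed.

(** The partial of 1/u is -(1/u)^2 times the partial of u, so the induction hypothesis on 1/u itself
    gives the next order. *)
Lemma Ck_onV n U u : Ck_on n U u -> (forall z, U z -> u z != 0) ->
  open U -> Ck_on n U (fun z => (u z)^-1).
Proof.
move=> + u0 oU; elim: n => [|n IH] su.
  split=> // z; rewrite inE => Uz.
  by apply: cvgV (u0 _ Uz) (su.1 z _); rewrite inE.
have wu := Ck_onW su.
split.
  by move=> z; rewrite inE => Uz; apply: cvgV (u0 _ Uz) (su.1 z _); rewrite inE.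
move=> v dv; have [eu pu] := su.2 v dv.
have dV z : U z -> is_derive (0 : R) 1 (fun t : R => (u (z + t%:C * v))^-1)
    (- (u z)^-1 * (u z)^-1 * rpartial v u z).
  move=> Uz; have Uz' : z \in U by rewrite inE.
  have un0 : u (z + (0 : R)%:C * v) != 0 by rewrite mul0r addr0; exact: u0.
  have /derivableP h := eu z Uz'.
  have := @is_deriveV _ _ _ _ _ un0 h.
  rewrite mul0r addr0 /rpartial derive1E /GRing.scale /=.
  by rewrite expr2 invfM !mulNr.
split.
  by move=> z; rewrite inE => Uz; have [] := dV z Uz.
have sN := Ck_onM (Ck_onM (Ck_onM (Ck_on_cst n U (-1)) (IH wu) oU) (IH wu) oU)
  pu oU.
apply: eq_Ck_on oU _ sN => z Uz.
rewrite [RHS]/rpartial derive1E; have h := dV z Uz; rewrite derive_val.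
by rewrite mulN1r.
Qed.

Lemma Ck_on_wdiff U u z : open U -> U z -> Ck_on 1 U u ->
  wdiff (fun w => (u w)%:C) z
    (((rpartial 1 u z)%:C - 'i%C * (rpartial 'i%C u z)%:C) / 2)
    (((rpartial 1 u z)%:C + 'i%C * (rpartial 'i%C u z)%:C) / 2).
Proof.
move=> oU Uz [_ h].
have [e1 [c1 _]] := h 1 (or_introl erefl).
have [ei [ci _]] := h 'i%C (or_intror erefl).
apply: (C1_wdiff oU Uz e1 ei); [apply: c1|apply: ci]; by rewrite inE.
Qed.

Lemma wdiff_ReIm F z P Q P' Q' :
  wdiff (fun w => (complex.Re (F w))%:C) z P Q ->
  wdiff (fun w => (complex.Im (F w))%:C) z P' Q' ->
  wdiff F z (P + 'i%C * P') (Q + 'i%C * Q').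
Proof.
move=> hr hi.
have := wdiffD hr (wdiffM (wdiff_cst 'i%C z) hi); rewrite !mul0r !add0r.
apply: near_eq_wdiff; apply: near_all => w.
by rewrite [RHS]complexE.
Qed.

Lemma Ck_on_wdiffable U F z : open U -> U z ->
  Ck_on 1 U (fun w => complex.Re (F w)) ->
  Ck_on 1 U (fun w => complex.Im (F w)) -> wdiffable F z.
Proof.
move=> oU Uz sr si; eexists; eexists.
exact: (wdiff_ReIm (Ck_on_wdiff oU Uz sr) (Ck_on_wdiff oU Uz si)).
Qed.

(** The real chain rule, which the induction on the order of smoothness needs, is read off the
    Wirtinger one. *)
Lemma is_derive_comp U F u z v : open U -> U (F z) -> Ck_on 1 U u ->
  wdiffable F z ->
  is_derive (0 : R) 1 (fun t : R => u (F (z + t%:C * v)))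
    (rpartial 1 u (F z) * rpartial v (fun w => complex.Re (F w)) z +
     rpartial 'i%C u (F z) * rpartial v (fun w => complex.Im (F w)) z).
Proof.
move=> oU UFz su [P [Q dF]].
have cE := wdiff_cpartial v dF.
have [h _] := wdiff_is_derive_ReIm v (wdiff_comp dF (Ck_on_wdiff oU UFz su)).
apply: (is_derive_eq h); rewrite /cpartial in cE.
set a := rpartial 1 u _; set b := rpartial 'i%C u _.
set c := rpartial v _ z in cE *; set d := rpartial v _ z in cE *.
(* Regroup around P v + Q v^*, the partial of F along v, and its conjugate; by [cE] the former is c
   + i d. *)
have -> :
   ((a%:C - 'i%C * b%:C) / 2 * P + (a%:C + 'i%C * b%:C) / 2 * Q^*%C) * v +
   ((a%:C - 'i%C * b%:C) / 2 * Q + (a%:C + 'i%C * b%:C) / 2 * P^*%C) * v^*%C =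
   (a%:C - 'i%C * b%:C) / 2 * (P * v + Q * v^*%C) +
   (a%:C + 'i%C * b%:C) / 2 * (P * v + Q * v^*%C)^*%C.
  by rewrite conjcD !conjcM conjcK; ring.
rewrite -cE.
have -> : (Complex c d : cplx R) = c%:C + 'i%C * d%:C by rewrite [LHS]complexE.
rewrite conjcD conjcM !conjc_real.
have -> : ('i%C : cplx R)^*%C = - 'i%C by rewrite /= ; congr Complex; ring.
rewrite -[RHS]/(complex.Re (a * c + b * d)%:C); congr complex.Re.
rewrite rmorphD !rmorphM.
rewrite -/(real_complex R a) -/(real_complex R b) -/(real_complex R c)
  -/(real_complex R d).
have := sqr_i R; rewrite expr2.
move: (Complex 0 1 : cplx R) => i ii.
have -> : (a%:C - i * b%:C) / 2 * (c%:C + i * d%:C) +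
  (a%:C + i * b%:C) / 2 * (c%:C + - i * d%:C) =
  a%:C * c%:C - (i * i) * b%:C * d%:C by field.
by rewrite ii; ring.
Qed.

(** The chain rule writes a partial of the composite as a sum of products of partials of u composed
    with F, covered by the induction hypothesis, and partials of the two components of F. *)
Lemma Ck_on_comp n U V F u : open U -> open V -> (forall z, U z -> V (F z)) ->
  Ck_on n U (fun w => complex.Re (F w)) ->
  Ck_on n U (fun w => complex.Im (F w)) ->
  Ck_on n V u -> Ck_on n U (u \o F).
Proof.
move=> oU oV FUV; elim: n u => [|n IH] u sr si su.
  split=> // z Uz; have FV : F z \in V.
    by rewrite inE; apply: FUV; rewrite inE in Uz.
  have cF : F @ z --> F z.
    apply/(@cvg_cplxP _ _ _ (nbhs_filter z)).
    by split; [exact: sr.1|exact: si.1].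
  exact: (cvg_comp _ _ cF (su.1 _ FV)).
have wr := Ck_onW sr; have wi := Ck_onW si.
have s1 m (w : cplx R -> R) W : Ck_on m.+1 W w -> Ck_on 1 W w.
  by elim: m => // m IHm /Ck_onW.
have d z v : U z -> is_derive (0 : R) 1 (fun t : R => u (F (z + t%:C * v)))
    (rpartial 1 u (F z) * rpartial v (fun w => complex.Re (F w)) z +
     rpartial 'i%C u (F z) * rpartial v (fun w => complex.Im (F w)) z).
  move=> Uz; apply: (is_derive_comp _ oV (FUV _ Uz) (s1 _ _ _ su)).
  exact: (Ck_on_wdiffable oU Uz (s1 _ _ _ sr) (s1 _ _ _ si)).
split.
  move=> z Uz; have FV : F z \in V.
    by rewrite inE; apply: FUV; rewrite inE in Uz.
  have cF : F @ z --> F z.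
    apply/(@cvg_cplxP _ _ _ (nbhs_filter z)).
    by split; [exact: sr.1|exact: si.1].
  exact: (cvg_comp _ _ cF (su.1 _ FV)).
move=> v dv; split.
  by move=> z; rewrite inE => Uz; have [] := d z v Uz.
have t1 := Ck_onM (IH _ wr wi (Ck_on_rpartial su (or_introl erefl)))
  (Ck_on_rpartial sr dv) oU.
have t2 := Ck_onM (IH _ wr wi (Ck_on_rpartial su (or_intror erefl)))
  (Ck_on_rpartial si dv) oU.
apply: eq_Ck_on oU _ (Ck_onD t1 t2 oU) => z Uz.
by have dd := d z v Uz; rewrite [RHS]/rpartial derive1E derive_val.
Qed.

End Smooth.

(** * Holomorphic functions *)

Section Holomorphic.
Variable R : realType.
Implicit Types (z w v : cplx R) (u : cplx R -> R) (U V : set (cplx R))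
  (F G : cplx R -> cplx R).

Definition csmooth_on U F :=
  smooth_on U (fun z => complex.Re (F z)) /\
  smooth_on U (fun z => complex.Im (F z)).

Lemma csmooth_wdiff U F z : open U -> U z -> csmooth_on U F ->
  wdiff F z (dz F z) (dzbar F z).
Proof.
by move=> oU Uz [sr si]; apply: wdiffableP; exact: (Ck_on_wdiffable oU Uz).
Qed.

Lemma eq_csmooth_on U F G : open U -> (forall w, U w -> F w = G w) ->
  csmooth_on U F -> csmooth_on U G.
Proof.
move=> oU E [sr si].
by split=> n; [apply: eq_Ck_on oU _ (sr n)|apply: eq_Ck_on oU _ (si n)]
  => w /E ->.
Qed.

Lemma csmooth_on_comp U V F G : open U -> open V ->
  (forall z, U z -> V (F z)) ->
  csmooth_on U F -> csmooth_on V G -> csmooth_on U (G \o F).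
Proof.
move=> oU oV FUV [sr si] [tr ti]; split=> n.
  exact: (Ck_on_comp oU oV FUV (sr n) (si n) (tr n)).
exact: (Ck_on_comp oU oV FUV (sr n) (si n) (ti n)).
Qed.

Lemma smooth_onM U u u' : open U -> smooth_on U u -> smooth_on U u' ->
  smooth_on U (fun z => u z * u' z).
Proof. by move=> oU su su' n; exact: Ck_onM. Qed.

Lemma smooth_onD U u u' : open U -> smooth_on U u -> smooth_on U u' ->
  smooth_on U (fun z => u z + u' z).
Proof. by move=> oU su su' n; exact: Ck_onD. Qed.

Lemma smooth_onN U u : open U -> smooth_on U u -> smooth_on U (fun z => - u z).
Proof.
move=> oU su n; apply: eq_Ck_on oU _ (Ck_onM (Ck_on_cst n U (-1)) (su n) oU).
by move=> w _; rewrite mulN1r.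
Qed.

Lemma smooth_onV U u : open U -> (forall z, U z -> u z != 0) ->
  smooth_on U u -> smooth_on U (fun z => (u z)^-1).
Proof. by move=> oU u0 su n; exact: Ck_onV. Qed.

Lemma csmooth_onM U F G : open U -> csmooth_on U F -> csmooth_on U G ->
  csmooth_on U (fun z => F z * G z).
Proof.
move=> oU [sr si] [tr ti]; split.
- move=> n; apply: eq_Ck_on oU _ (smooth_onD oU (smooth_onM oU sr tr)
    (smooth_onN oU (smooth_onM oU si ti)) n).
  by move=> w _; case: (F w) (G w) => ? ? [].
- move=> n; apply: eq_Ck_on oU _ (smooth_onD oU (smooth_onM oU sr ti)
    (smooth_onM oU si tr) n).
  by move=> w _; case: (F w) (G w) => ? ? [].
Qed.

Lemma sqmod_eq0 z : (sqmod z == 0) = (z == 0).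
Proof.
rewrite /sqmod paddr_eq0 ?sqr_ge0// !sqrf_eq0.
by case: z => a b; rewrite eq_complex.
Qed.

(** 1/F is the conjugate of F divided by the real function |F|^2, so the real inverse rule
    applies. *)
Lemma csmooth_onV U F : open U -> (forall z, U z -> F z != 0) ->
  csmooth_on U F -> csmooth_on U (fun z => (F z)^-1).
Proof.
move=> oU F0 [sr si].
have s2 : smooth_on U (fun z => (sqmod (F z))^-1).
  apply: smooth_onV => //; first by move=> z /F0; rewrite sqmod_eq0.
  move=> n; apply: eq_Ck_on oU _ (smooth_onD oU (smooth_onM oU sr sr)
    (smooth_onM oU si si) n).
  by move=> w _; rewrite /sqmod !expr2.
split.
- move=> n; apply: eq_Ck_on oU _ (smooth_onM oU sr s2 n).
  by move=> w _; rewrite /sqmod; case: (F w).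
- move=> n; apply: eq_Ck_on oU _ (smooth_onN oU (smooth_onM oU si s2) n).
  by move=> w _; rewrite /sqmod; case: (F w).
Qed.

Lemma hol_csmooth U F : holomorphic_on U F -> csmooth_on U F.
Proof. by case. Qed.

Lemma hol_wdiff U F z : open U -> U z -> holomorphic_on U F ->
  wdiff F z (dz F z) 0.
Proof.
move=> oU Uz hF; rewrite -(hol_CR hF (mem_set Uz)).
exact: (csmooth_wdiff oU Uz (hol_csmooth hF)).
Qed.

Lemma holP U F : csmooth_on U F -> (forall z, U z -> dzbar F z = 0) ->
  holomorphic_on U F.
Proof. by move=> [sr si] h; split=> // z; rewrite inE => /h. Qed.

Lemma eq_hol U F G : open U -> (forall w, U w -> F w = G w) ->
  holomorphic_on U F -> holomorphic_on U G.
Proof.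
move=> oU E hF; apply: holP; first exact: eq_csmooth_on oU E (hol_csmooth hF).
by move=> z Uz; rewrite -(eq_dzbar oU Uz E); apply: hol_CR hF _ _; rewrite inE.
Qed.

Lemma hol_local U F :
  (forall z, U z -> exists2 V, V z & holomorphic_on V F) -> holomorphic_on U F.
Proof.
move=> h; split.
- by move=> n; apply: Ck_on_local => z /h[V Vz [sr _ _]]; exists V.
- by move=> n; apply: Ck_on_local => z /h[V Vz [_ si _]]; exists V.
- by move=> z; rewrite inE => /h[V Vz [_ _]]; apply; rewrite inE.
Qed.

Lemma hol_sub U V F : V `<=` U -> holomorphic_on U F -> holomorphic_on V F.
Proof.
by move=> VU hF; apply: hol_local => z /VU Uz; exists U.
Qed.

Lemma holM U F G : open U -> holomorphic_on U F -> holomorphic_on U G ->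
  holomorphic_on U (fun z => F z * G z).
Proof.
move=> oU hF hG; apply: holP.
  by apply: csmooth_onM => //; exact: hol_csmooth.
move=> z Uz; rewrite (wdiff_dzbar (wdiffM (hol_wdiff oU Uz hF)
  (hol_wdiff oU Uz hG))).
by rewrite mul0r mulr0 addr0.
Qed.

Lemma holV U F : open U -> (forall z, U z -> F z != 0) -> holomorphic_on U F ->
  holomorphic_on U (fun z => (F z)^-1).
Proof.
move=> oU F0 hF; apply: holP.
  by apply: csmooth_onV => //; exact: hol_csmooth.
move=> z Uz; rewrite (wdiff_dzbar (wdiffV (F0 z Uz) (hol_wdiff oU Uz hF))).
by rewrite oppr0 mul0r.
Qed.

Lemma hol_comp U V F G : open U -> open V -> (forall z, U z -> V (F z)) ->
  holomorphic_on U F -> holomorphic_on V G -> holomorphic_on U (G \o F).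
Proof.
move=> oU oV FUV hF hG; apply: holP.
  by apply: csmooth_on_comp oU oV FUV _ _; exact: hol_csmooth.
move=> z Uz; rewrite (wdiff_dzbar (wdiff_comp (hol_wdiff oU Uz hF)
  (hol_wdiff oV (FUV z Uz) hG))).
by rewrite mulr0 mul0r addr0.
Qed.

Lemma dz_comp U V F G z : open U -> open V -> U z -> V (F z) ->
  holomorphic_on U F -> holomorphic_on V G ->
  dz (G \o F) z = dz G (F z) * dz F z.
Proof.
move=> oU oV Uz VFz hF hG; rewrite (wdiff_dz (wdiff_comp (hol_wdiff oU Uz hF)
  (hol_wdiff oV VFz hG))).
by rewrite mul0r addr0.
Qed.

Lemma dz_id z : dz id z = 1.
Proof. exact: wdiff_dz (wdiff_id z). Qed.

(** These are the Cauchy-Riemann equations in real form, ready to be differentiated once more. *)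
Lemma dzbar_eq0P F z : dzbar F z = 0 <->
  rpartial 1 (fun w => complex.Re (F w)) z =
    rpartial 'i%C (fun w => complex.Im (F w)) z /\
  rpartial 1 (fun w => complex.Im (F w)) z =
    - rpartial 'i%C (fun w => complex.Re (F w)) z.
Proof.
rewrite /dzbar /cpartial; set a := rpartial _ _ _; set b := rpartial _ _ _.
set c := rpartial _ _ _; set d := rpartial _ _ _.
have n2 : (2%:R : cplx R)^-1 != 0 by rewrite invr_eq0 pnatr_eq0.
have E : (Complex a b : cplx R) + 'i%C * Complex c d = Complex (a - d) (b + c).
  by apply/eqP; rewrite eq_complex /=; apply/andP; split; apply/eqP; ring.
rewrite E; split.
- move=> /eqP; rewrite mulf_eq0 (negbTE n2) orbF eq_complex /=.
  move=> /andP[/eqP h1 /eqP h2]; split; first exact: subr0_eq.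
  by apply/eqP; rewrite -addr_eq0; apply/eqP.
- by move=> [-> ->]; rewrite subrr addNr mul0r.
Qed.

(** Holomorphy says that i times the partial along y is minus the partial along x, so the two halves
    of [dz] agree. *)
Lemma hol_dzE U F z : U z -> holomorphic_on U F ->
  dz F z = Complex (rpartial 1 (fun w => complex.Re (F w)) z)
                   (rpartial 1 (fun w => complex.Im (F w)) z).
Proof.
move=> Uz hF; have := hol_CR hF (mem_set Uz); rewrite /dz /dzbar.
rewrite -/(cpartial 1 F z); set c := cpartial 1 F z => E.
have {}E : c + 'i%C * cpartial 'i%C F z = 0.
  by apply/eqP; move/eqP: E; rewrite mulf_eq0 invr_eq0 pnatr_eq0 orbF.
have -> : 'i%C * cpartial 'i%C F z = - c.
  by apply/eqP; rewrite -addr_eq0 addrC E.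
by rewrite opprK; field.
Qed.

Lemma smooth_Schwarz U u z : open U -> U z -> smooth_on U u ->
  rpartial 'i%C (rpartial 1 u) z = rpartial 1 (rpartial 'i%C u) z.
Proof.
move=> oU Uz su.
have h1 := su 2; have d1 : (1 : cplx R) = 1 \/ (1 : cplx R) = 'i%C by left.
have di : ('i%C : cplx R) = 1 \/ ('i%C : cplx R) = 'i%C by right.
have s1 := Ck_on_rpartial h1 d1; have si := Ck_on_rpartial h1 di.
have Uz' := mem_set Uz.
apply: (Schwarz oU Uz).
- exact: Ck_on_rpartial_exists h1 d1.
- exact: Ck_on_rpartial_exists h1 di.
- exact: Ck_on_rpartial_exists s1 di.
- exact: Ck_on_rpartial_exists si d1.
- exact: (Ck_on_continuous (Ck_on_rpartial s1 di) Uz').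
- exact: (Ck_on_continuous (Ck_on_rpartial si d1) Uz').
Qed.

(** On U the derivative is the partial of F along x. Its Cauchy-Riemann equations are the x-partials
    of those of F, once the order of differentiation is exchanged. *)
Lemma hol_dz U F : open U -> holomorphic_on U F -> holomorphic_on U (dz F).
Proof.
move=> oU hF.
pose G z : cplx R := Complex (rpartial 1 (fun w => complex.Re (F w)) z)
                   (rpartial 1 (fun w => complex.Im (F w)) z).
have [sr si _] := hF.
have E z : U z -> dzbar F z = 0 by move=> Uz; apply: hol_CR hF _ _; rewrite inE.
apply: (@eq_hol U G) => //; first by move=> z Uz; rewrite (hol_dzE Uz hF).
apply: holP.
  by split=> n; apply: (Ck_on_rpartial _ (or_introl erefl)).
move=> z Uz; apply/dzbar_eq0P; split => /=.
  rewrite (smooth_Schwarz oU Uz si); apply: (eq_rpartial _ oU Uz) => w Uw.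
  by have /dzbar_eq0P[] := E w Uw.
rewrite (smooth_Schwarz oU Uz sr).
have Uz' := mem_set Uz.
have -> : rpartial 1 (rpartial 1 (fun w => complex.Im (F w))) z =
    rpartial 1 (fun w => - rpartial 'i%C (fun w => complex.Re (F w)) w) z.
  apply: (eq_rpartial _ oU Uz) => w Uw.
  by have /dzbar_eq0P[] := E w Uw.
rewrite /rpartial [LHS]derive1E [in RHS]derive1E; apply: deriveN.
have := Ck_on_rpartial_exists (Ck_on_rpartial (sr 2) (or_intror erefl))
  (or_introl erefl) Uz'.
exact.
Qed.

End Holomorphic.

(** * The Chern curvature *)

Section Curvature.
Variable R : realType.
Implicit Types (z w v : cplx R) (k : cplx R -> R) (U V : set (cplx R))
  (F G : cplx R -> cplx R).

Lemma csmooth_on_cst U (c : cplx R) : csmooth_on U (fun=> c).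
Proof. by split=> n; exact: Ck_on_cst. Qed.

Lemma csmooth_onD U F G : open U -> csmooth_on U F -> csmooth_on U G ->
  csmooth_on U (fun z => F z + G z).
Proof.
move=> oU [sr si] [tr ti]; split=> n.
- apply: eq_Ck_on oU _ (smooth_onD oU sr tr n).
  by move=> w _; case: (F w) (G w) => ? ? [].
- apply: eq_Ck_on oU _ (smooth_onD oU si ti n).
  by move=> w _; case: (F w) (G w) => ? ? [].
Qed.

Lemma csmooth_on_real U k : smooth_on U k -> csmooth_on U (fun z => (k z)%:C).
Proof. by move=> sk; split=> //; move=> n; exact: Ck_on_cst. Qed.

Lemma csmooth_on_cpartial U F v : v = 1 \/ v = 'i%C -> csmooth_on U F ->
  csmooth_on U (cpartial v F).
Proof.
by move=> dv [sr si]; split=> n; [exact: Ck_on_rpartial (sr _) dv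
  |exact: Ck_on_rpartial (si _) dv].
Qed.

Lemma csmooth_on_dz U F : open U -> csmooth_on U F -> csmooth_on U (dz F).
Proof.
move=> oU sF.
have s1 := csmooth_on_cpartial (or_introl erefl) sF.
have si := csmooth_on_cpartial (or_intror erefl) sF.
have := csmooth_onM oU (csmooth_onD oU s1
  (csmooth_onM oU (csmooth_on_cst U (- 'i%C)) si)) (csmooth_on_cst U 2%:R^-1).
by apply: eq_csmooth_on => // w _; rewrite mulNr.
Qed.

(** The dz coefficient of the Chern form, that is, the derivative of log k along z. *)
Definition dlog k z : cplx R := dz (fun w => (k w)%:C) z / (k z)%:C.

Lemma real_neq0 (x : R) : 0 < x -> (x%:C : cplx R) != 0.
Proof. by move=> x0; rewrite eq_complex /= eqxx andbT gt_eqF. Qed.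

Lemma csmooth_on_dlog U k : open U -> (forall z, U z -> 0 < k z) ->
  smooth_on U k -> csmooth_on U (dlog k).
Proof.
move=> oU k0 sk; have sC := csmooth_on_real sk.
apply: csmooth_onM oU (csmooth_on_dz oU sC) (csmooth_onV oU _ sC).
by move=> z /k0; exact: real_neq0.
Qed.

(** In d(A dz) only the d-bar part of dA survives, and the wedge of the conjugate of dz with dz is
    2i times that of dx with dy. *)
Lemma chern_curvatureE U k z : open U -> U z -> (forall z, U z -> 0 < k z) ->
  smooth_on U k -> chern_curvature k z = 2%:R * 'i%C * dzbar (dlog k) z.
Proof.
move=> oU Uz k0 sk.
have sA := csmooth_on_dlog oU k0 sk.
have dA := csmooth_wdiff oU Uz sA.
rewrite /chern_curvature /ext_d /chern_form /= -/(dlog k).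
have diA := wdiffM (wdiff_cst 'i%C z) dA; rewrite !mul0r !add0r in diA.
rewrite (wdiff_cpartial _ diA) (wdiff_cpartial _ dA) conjc1.
have -> : ('i%C : cplx R)^*%C = - 'i%C by rewrite /= ; congr Complex; ring.
move: (dz _ _) (dzbar _ _) => P Q; move: (Complex 0 1 : cplx R) => i.
by ring.
Qed.

Lemma eq_chern_curvature U k k' z : open U -> U z ->
  (forall z, U z -> 0 < k z) -> smooth_on U k ->
  (forall w, U w -> k w = k' w) ->
  chern_curvature k z = chern_curvature k' z.
Proof.
move=> oU Uz k0 sk E.
have k0' w : U w -> 0 < k' w by move=> Uw; rewrite -E ?k0.
have sk' : smooth_on U k' by move=> n; exact: eq_Ck_on oU E (sk n).
rewrite (chern_curvatureE oU Uz k0 sk) (chern_curvatureE oU Uz k0' sk').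
congr (_ * _); apply: (eq_dzbar oU Uz) => w Uw; rewrite /dlog E//.
by congr (_ / _); apply: (eq_dz oU Uw) => x /E ->.
Qed.

Lemma wdiff_real U k z : open U -> U z -> smooth_on U k ->
  wdiff (fun w => (k w)%:C) z (dz (fun w => (k w)%:C) z)
    (dzbar (fun w => (k w)%:C) z).
Proof. by move=> oU Uz /csmooth_on_real; exact: csmooth_wdiff. Qed.

Lemma chern_curvatureM U k k' z : open U -> U z ->
  (forall z, U z -> 0 < k z) -> (forall z, U z -> 0 < k' z) ->
  smooth_on U k -> smooth_on U k' ->
  chern_curvature (fun w => k w * k' w) z =
  chern_curvature k z + chern_curvature k' z.
Proof.
move=> oU Uz k0 k0' sk sk'.
have p0 w : U w -> 0 < k w * k' w by move=> Uw; rewrite mulr_gt0 ?k0 ?k0'.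
rewrite (chern_curvatureE oU Uz p0 (smooth_onM oU sk sk')).
rewrite (chern_curvatureE oU Uz k0 sk) (chern_curvatureE oU Uz k0' sk').
rewrite -mulrDr; congr (_ * _).
have E w : U w -> dlog k w + dlog k' w = dlog (fun w => k w * k' w) w.
  move=> Uw; rewrite /dlog.
  have -> : dz (fun w => (k w * k' w)%:C) w = dz (fun w => (k w)%:C) w *
      (k' w)%:C + (k w)%:C * dz (fun w => (k' w)%:C) w.
    apply: wdiff_dz; apply: near_eq_wdiff (wdiffM (wdiff_real oU Uw sk)
      (wdiff_real oU Uw sk')).
    by apply: near_all => x; rewrite rmorphM.
  have n0 := real_neq0 (k0 w Uw); have n0' := real_neq0 (k0' w Uw).
  rewrite rmorphM -/(real_complex R (k w)) -/(real_complex R (k' w)).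
  by field; apply/andP.
rewrite -(eq_dzbar oU Uz E).
have d1 := csmooth_wdiff oU Uz (csmooth_on_dlog oU k0 sk).
have d2 := csmooth_wdiff oU Uz (csmooth_on_dlog oU k0' sk').
exact: wdiff_dzbar (wdiffD d1 d2).
Qed.

Lemma chern_curvatureV U k z : open U -> U z -> (forall z, U z -> 0 < k z) ->
  smooth_on U k ->
  chern_curvature (fun w => (k w)^-1) z = - chern_curvature k z.
Proof.
move=> oU Uz k0 sk.
have p0 w : U w -> 0 < (k w)^-1 by move=> Uw; rewrite invr_gt0 k0.
have kn0 w : U w -> k w != 0 by move=> Uw; rewrite gt_eqF ?k0.
rewrite (chern_curvatureE oU Uz p0 (smooth_onV oU kn0 sk)).
rewrite (chern_curvatureE oU Uz k0 sk) -mulrN; congr (_ * _).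
(* The sign is written as a constant factor so that the product rule differentiates it. *)
have E w : U w -> -1 * dlog k w = dlog (fun w => (k w)^-1) w.
  move=> Uw; rewrite /dlog; have n0 := real_neq0 (k0 w Uw).
  have -> : dz (fun w => ((k w)^-1)%:C) w =
      - dz (fun w => (k w)%:C) w / (k w)%:C ^+ 2.
    apply: wdiff_dz; apply: near_eq_wdiff (wdiffV n0 (wdiff_real oU Uw sk)).
    by apply: near_all => x; rewrite fmorphV.
  by rewrite fmorphV -/(real_complex R (k w)); field.
rewrite -(eq_dzbar oU Uz E).
have d1 := csmooth_wdiff oU Uz (csmooth_on_dlog oU k0 sk).
by rewrite (wdiff_dzbar (wdiffM (wdiff_cst (-1) z) d1)) mul0r add0r mulN1r.
Qed.

Lemma sqmodE z : ((sqmod z)%:C : cplx R) = z * z^*%C.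
Proof.
rewrite /sqmod; case: z => a b /=; apply/eqP; rewrite eq_complex /=.
by apply/andP; split; apply/eqP; ring.
Qed.

(** The coefficient of the Chern form becomes (dlog k o F) F'. Since F' is holomorphic, d-bar acts
    on the first factor alone, and there the chain rule brings out the conjugate of F'; together
    with F' it makes |F'|^2. *)
Lemma chern_curvature_comp U V F k z : open U -> open V ->
  (forall z, U z -> V (F z)) -> U z ->
  holomorphic_on U F -> (forall z, V z -> 0 < k z) -> smooth_on V k ->
  chern_curvature (k \o F) z = (sqmod (dz F z))%:C * chern_curvature k (F z).
Proof.
move=> oU oV FUV Uz hF k0 sk.
have [sr si _] := hF.
have p0 w : U w -> 0 < (k \o F) w by move=> /FUV/k0.
have skF : smooth_on U (k \o F) by move=> n; exact: (Ck_on_comp oU oV FUV).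
rewrite (chern_curvatureE oU Uz p0 skF) (chern_curvatureE oV (FUV z Uz) k0 sk).
have E w : U w -> (dlog k \o F) w * dz F w = dlog (k \o F) w.
  move=> Uw; rewrite /dlog /=.
  have /wdiff_dz -> := wdiff_comp (hol_wdiff oU Uw hF)
    (wdiff_real oV (FUV w Uw) sk).
  by rewrite conjc0 mulr0 addr0 mulrAC.
rewrite -(eq_dzbar oU Uz E).
have d1 := csmooth_wdiff oV (FUV z Uz) (csmooth_on_dlog oV k0 sk).
have d2 := hol_wdiff oU Uz (hol_dz oU hF).
rewrite (wdiff_dzbar (wdiffM (wdiff_comp (hol_wdiff oU Uz hF) d1) d2)).
by rewrite sqmodE; ring.
Qed.

End Curvature.

(** * Line bundles *)

Section Charts.
Variable R : realType.

Lemma in_chart_open (X : topologicalType) (c : chart R X) (U : set X) :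
  open U -> open (in_chart c U).
Proof.
move=> oU; rewrite openE => z [cz Uz]; rewrite /interior.
have h1 : nbhs z (cimg c).
  by apply: open_nbhs_nbhs; split => //; exact: cimg_open.
have h2 : nbhs z (cinv c @^-1` U).
  apply: (cinv_continuous (mem_set cz)).
  by apply: open_nbhs_nbhs; split.
exact: filterI.
Qed.

Arguments in_chart_open {X} c {U}.

Lemma in_chart_zcoord (X : topologicalType) (c : chart R X) (U : set X) x :
  cdom c x -> U x -> in_chart c U (zcoord c x).
Proof.
move=> cx Ux; split; first exact: zcoord_img.
by rewrite /preimage /= (zcoordK (mem_set cx)).
Qed.

Lemma in_chartS (X : topologicalType) (c : chart R X) (U V : set X) :
  U `<=` V -> in_chart c U `<=` in_chart c V.
Proof. by move=> UV z [cz /UV Uz]. Qed.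

Lemma preimage_open (S T : topologicalType) (f : S -> T) (V : set T) :
  continuous f -> open V -> open (f @^-1` V).
Proof. by move=> cf oV; apply: open_comp => // x _; exact: cf. Qed.

Variables (X Y : riemannSurface R) (f : Y -> X).
Hypothesis hf : holomorphic_map f.

(** The image under f of a chart of Y need not lie in one chart of X. Around each point a chart b of
    X is chosen and the domain shrunk to W, which suffices because smoothness and holomorphy are
    local. *)
Lemma pullback_chart (a : rs_idx Y) (V : set X) z : open V ->
  in_chart (rs_chart a) (f @^-1` V) z ->
  exists b W, [/\ open W, W z, W `<=` in_chart (rs_chart a) (f @^-1` V),
    holomorphic_on W (zcoord (rs_chart b) \o f \o cinv (rs_chart a)) &
    forall w, W w ->
      in_chart (rs_chart b) V
        ((zcoord (rs_chart b) \o f \o cinv (rs_chart a)) w) /\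
      cinv (rs_chart b) ((zcoord (rs_chart b) \o f \o cinv (rs_chart a)) w) =
        f (cinv (rs_chart a) w)].
Proof.
move=> oV [az Vz]; have [cf hF] := hf.
have [b bz] := rs_cover (f (cinv (rs_chart a) z)).
exists b, (in_chart (rs_chart a) (f @^-1` (V `&` cdom (rs_chart b)))).
split.
- apply: in_chart_open; apply: preimage_open => //.
  by apply: openI => //; exact: cdom_open.
- by split.
- by apply: in_chartS => y [].
- by apply: hol_sub (hF a b); apply: in_chartS => y [].
- move=> w [aw [Vw bw]]; split; last by rewrite /= zcoordK// inE.
  exact: in_chart_zcoord.
Qed.

Lemma holomorphic_fun_pullback (V : set X) (u : X -> cplx R) :
  open V -> holomorphic_fun V u -> holomorphic_fun (f @^-1` V) (u \o f).
Proof.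
move=> oV hu a; apply: hol_local => z Wz.
have [b [W [oW Wz' WV hF E]]] := pullback_chart oV Wz.
exists W => //.
have := hol_comp oW (in_chart_open (rs_chart b) oV)
  (fun w Ww => (E w Ww).1) hF (hu b).
by apply: eq_hol => // w /E [_] /= ->.
Qed.

Lemma smooth_fun_pullback (V : set X) (u : X -> R) :
  open V -> smooth_fun V u -> smooth_fun (f @^-1` V) (u \o f).
Proof.
move=> oV su a n; apply: Ck_on_local => z Wz.
have [b [W [oW Wz' WV [sr si _] E]]] := pullback_chart oV Wz.
exists W => //.
have := Ck_on_comp oW (in_chart_open (rs_chart b) oV) (fun w Ww => (E w Ww).1)
  (sr n) (si n) (su b n).
by apply: eq_Ck_on => // w /E [_] /= ->.
Qed.

End Charts.

Arguments in_chart_open {R X} c {U}.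

Section Bundles.
Variable R : realType.

Lemma sqmodM (z w : cplx R) : sqmod (z * w) = sqmod z * sqmod w.
Proof. by case: z w => a b [c d]; rewrite /sqmod /=; ring. Qed.

Lemma sqmodV (z : cplx R) : sqmod z^-1 = (sqmod z)^-1.
Proof.
have [->|z0] := eqVneq z 0.
  by rewrite invr0 /sqmod /= !expr0n addr0 invr0.
have s0 : sqmod z != 0 by rewrite sqmod_eq0.
apply: (mulfI s0); rewrite -sqmodM !mulfV// /sqmod /=.
by rewrite expr1n expr0n addr0.
Qed.

Lemma holomorphic_funM (X : riemannSurface R) (U : set X) (u v : X -> cplx R) :
  open U -> holomorphic_fun U u -> holomorphic_fun U v ->
  holomorphic_fun U (fun x => u x * v x).
Proof.
by move=> oU hu hv a; exact: (holM (in_chart_open _ oU) (hu a) (hv a)).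
Qed.

Lemma holomorphic_funV (X : riemannSurface R) (U : set X) (u : X -> cplx R) :
  open U -> (forall x, U x -> u x != 0) -> holomorphic_fun U u ->
  holomorphic_fun U (fun x => (u x)^-1).
Proof.
move=> oU u0 hu a; apply: (holV (in_chart_open _ oU) _ (hu a)).
by move=> z [_ /u0].
Qed.

Lemma holomorphic_fun_sub (X : riemannSurface R) (U V : set X)
    (u : X -> cplx R) :
  V `<=` U -> holomorphic_fun U u -> holomorphic_fun V u.
Proof. by move=> VU hu a; apply: hol_sub (hu a); exact: in_chartS. Qed.

(** Seen from another chart, a function of the coordinate b is its composite with a holomorphic
    change of coordinates. So holomorphy of transition functions and of df can be checked in the one
    chart that defines them. *)
Lemma holomorphic_fun_chart (X : riemannSurface R) (b : rs_idx X) (V : set X)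
    (G : cplx R -> cplx R) : open V ->
  holomorphic_on (in_chart (rs_chart b) V) G ->
  holomorphic_fun (cdom (rs_chart b) `&` V) (G \o zcoord (rs_chart b)).
Proof.
move=> oV hG c.
have oW : open (in_chart (rs_chart c) (cdom (rs_chart b) `&` V)).
  by apply: in_chart_open; apply: openI => //; exact: cdom_open.
have hT : holomorphic_on (in_chart (rs_chart c) (cdom (rs_chart b) `&` V))
    (zcoord (rs_chart b) \o cinv (rs_chart c)).
  by apply: hol_sub (rs_compat b c); apply: in_chartS => x [].
apply: (hol_comp oW (in_chart_open (rs_chart b) oV) _ hT hG).
by move=> z [cz [bz Vz]]; exact: in_chart_zcoord.
Qed.

(** * The holomorphic tangent bundle *)

Section Tangent.
Variable X : riemannSurface R.
Implicit Types (x : X) (i j k : lb_idx (tangent X)).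

(** This is the chain rule for the coordinate changes k to j to i, which compose to k to i on the
    triple overlap. *)
Lemma tangent_cocycle i j k x : lb_dom i x -> lb_dom j x -> lb_dom k x ->
  lb_trans i j x * lb_trans j k x = lb_trans i k x.
Proof.
rewrite /= => ix jx kx.
pose W := in_chart (rs_chart k) (cdom (rs_chart i) `&` cdom (rs_chart j)).
have oW : open W by apply: in_chart_open; apply: openI; exact: cdom_open.
have Wx : W (zcoord (rs_chart k) x) by exact: in_chart_zcoord.
have oV := in_chart_open (rs_chart j) (@cdom_open _ _ (rs_chart i)).
have hT : holomorphic_on W (zcoord (rs_chart j) \o cinv (rs_chart k)).
  by apply: hol_sub (rs_compat j k); apply: in_chartS => y [].
have Tx : (zcoord (rs_chart j) \o cinv (rs_chart k)) (zcoord (rs_chart k) x) =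
    zcoord (rs_chart j) x by rewrite /= zcoordK// inE.
have Vx := in_chart_zcoord jx ix.
rewrite -{1}Tx -(dz_comp oW oV Wx _ hT (rs_compat i j)); last by rewrite Tx.
apply: (eq_dz oW Wx) => w [kw [iw jw]] /=.
by rewrite zcoordK// inE.
Qed.

Lemma tangent_id i x : lb_dom i x -> lb_trans i i x = 1.
Proof.
rewrite /= => ix; rewrite -(dz_id (zcoord (rs_chart i) x)).
apply: (@eq_dz _ (cimg (rs_chart i))); first exact: cimg_open.
  exact: zcoord_img.
by move=> w iw /=; rewrite cinvK// inE.
Qed.

Lemma tangent_holomorphic : holomorphic_line_bundle (tangent X).
Proof.
split.
- by move=> i; exact: cdom_open.
- by move=> x; exact: rs_cover.
- move=> i j; rewrite setIC.
  apply: (@holomorphic_fun_chart _ j (cdom (rs_chart i))).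
    exact: cdom_open.
  apply: hol_dz; first by apply: in_chart_open; exact: cdom_open.
  exact: rs_compat.
(* By the cocycle identity for i, j, i, the derivative times that of the inverse change of
   coordinates is 1, so it cannot vanish. *)
- move=> i j x ix jx; apply/eqP => E.
  have := tangent_cocycle ix jx ix; rewrite tangent_id// E mul0r => /eqP.
  by rewrite eq_sym oner_eq0.
- exact: tangent_id.
- exact: tangent_cocycle.
Qed.

End Tangent.

(** * Duals and tensor products: bundles, metrics, sections, curvature *)

Section Operations.
Variable X : riemannSurface R.

Lemma dual_holomorphic (L : line_bundle R X) :
  holomorphic_line_bundle L -> holomorphic_line_bundle (dual L).
Proof.
move=> [oL cL hL nL iL kL]; split=> //=.
- move=> i j; apply: holomorphic_funV (hL i j); first exact: openI.
  by move=> x [ix jx]; exact: nL.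
- by move=> i j x ix jx; rewrite invr_eq0 nL.
- by move=> i x ix; rewrite iL// invr1.
- by move=> i j k x ix jx kx; rewrite -(kL i j k)// invfM.
Qed.

Lemma tensor_holomorphic (L M : line_bundle R X) :
  holomorphic_line_bundle L -> holomorphic_line_bundle M ->
  holomorphic_line_bundle (tensor L M).
Proof.
move=> [oL cL hL nL iL kL] [oM cM hM nM iM kM]; split=> /=.
- by move=> [i i']; exact: openI.
- by move=> x; have [i ix] := cL x; have [j jx] := cM x; exists (i, j).
- move=> [i i'] [j j'] /=; apply: holomorphic_funM.
  + by apply: openI; exact: openI.
  + by apply: holomorphic_fun_sub (hL i j) => x [[? ?] [? ?]].
  + by apply: holomorphic_fun_sub (hM i' j') => x [[? ?] [? ?]].
- by move=> [i i'] [j j'] x [/= ? ?] [/= ? ?]; rewrite mulf_neq0 ?nL ?nM.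
- by move=> [i i'] x [/= ? ?]; rewrite iL// iM// mulr1.
- move=> [i i'] [j j'] [k k'] x [/= ? ?] [/= ? ?] [/= ? ?].
  by rewrite -(kL i j k)// -(kM i' j' k')// mulrACA.
Qed.

Lemma dual_hermitian (L : line_bundle R X) (h : metric L) :
  (forall i : lb_idx L, open (lb_dom i)) ->
  hermitian_metric h -> hermitian_metric (dual_metric h).
Proof.
move=> oL [sh ph th]; split=> /=.
- move=> i a; apply: smooth_onV (sh i a); first exact: in_chart_open.
  by move=> z [_ iz]; rewrite gt_eqF//= ph.
- by move=> i x ix; rewrite /dual_metric invr_gt0 ph.
- by move=> i j x ix jx; rewrite /dual_metric (th i j)// sqmodV invfM.
Qed.

Lemma tensor_hermitian (L M : line_bundle R X) (h : metric L) (k : metric M) :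
  (forall i : lb_idx L, open (lb_dom i)) ->
  (forall i : lb_idx M, open (lb_dom i)) ->
  hermitian_metric h -> hermitian_metric k ->
  hermitian_metric (tensor_metric h k).
Proof.
move=> oL oM [sh ph th] [sk pk tk]; split=> /=.
- move=> [i j] a; apply: smooth_onM.
  + by apply: in_chart_open; exact: openI.
  + by move=> n; apply: Ck_on_sub (sh i a n); apply: in_chartS => x [].
  + by move=> n; apply: Ck_on_sub (sk j a n); apply: in_chartS => x [].
- by move=> [i j] x [/= ? ?]; rewrite /tensor_metric mulr_gt0 ?ph ?pk.
- move=> [i i'] [j j'] x [/= ? ?] [/= ? ?]; rewrite /tensor_metric /=.
  by rewrite (th i j)// (tk i' j')// sqmodM mulrACA.
Qed.

Lemma tensor_holomorphic_section (L M : line_bundle R X) (s : lsection L)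
    (t : lsection M) :
  (forall i : lb_idx L, open (lb_dom i)) ->
  (forall i : lb_idx M, open (lb_dom i)) ->
  holomorphic_section s -> holomorphic_section t ->
  holomorphic_section (tensor_section s t).
Proof.
move=> oL oM [hs ts] [ht tt]; split=> /=.
- move=> [i j]; apply: holomorphic_funM; first exact: openI.
  + by apply: holomorphic_fun_sub (hs i) => x [].
  + by apply: holomorphic_fun_sub (ht j) => x [].
- move=> [i i'] [j j'] x [/= ? ?] [/= ? ?]; rewrite /tensor_section /=.
  by rewrite (ts i j)// (tt i' j')// mulrACA.
Qed.

Lemma metric_chart (L : line_bundle R X) (h : metric L) (i : lb_idx L) a :
  hermitian_metric h ->
  let U := in_chart (rs_chart a) (lb_dom i) in
  (forall z, U z -> 0 < (h i \o cinv (rs_chart a)) z) /\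
  smooth_on U (h i \o cinv (rs_chart a)).
Proof.
by move=> [sh ph _] U; split; [move=> z [_ iz]; exact: ph|exact: sh].
Qed.

Lemma dual_curvature (L : line_bundle R X) (h : metric L) (i : lb_idx L) a x :
  (forall i : lb_idx L, open (lb_dom i)) -> hermitian_metric h ->
  lb_dom i x -> cdom (rs_chart a) x ->
  curvature (dual_metric h) i a x = - curvature h i a x.
Proof.
move=> oL hh ix ax; have [ph sh] := metric_chart i a hh.
exact: (chern_curvatureV (in_chart_open _ (oL i)) (in_chart_zcoord ax ix)
  ph sh).
Qed.

Lemma tensor_curvature (L M : line_bundle R X) (h : metric L) (k : metric M)
    (i : lb_idx L) (j : lb_idx M) a x :
  (forall i : lb_idx L, open (lb_dom i)) ->
  (forall i : lb_idx M, open (lb_dom i)) ->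
  hermitian_metric h -> hermitian_metric k ->
  lb_dom i x -> lb_dom j x -> cdom (rs_chart a) x ->
  curvature (tensor_metric h k) (i, j) a x =
  curvature h i a x + curvature k j a x.
Proof.
move=> oL oM hh hk ix jx ax.
have [ph sh] := metric_chart i a hh; have [pk sk] := metric_chart j a hk.
pose U := in_chart (rs_chart a) (lb_dom i `&` lb_dom j).
have oU : open U by apply: in_chart_open; exact: openI.
have Ux : U (zcoord (rs_chart a) x) by exact: in_chart_zcoord.
have Ui : U `<=` in_chart (rs_chart a) (lb_dom i) by apply: in_chartS => y [].
have Uj : U `<=` in_chart (rs_chart a) (lb_dom j) by apply: in_chartS => y [].
apply: (chern_curvatureM oU Ux).
- by move=> z /Ui/ph.
- by move=> z /Uj/pk.
- by move=> n; exact: Ck_on_sub Ui (sh n).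
- by move=> n; exact: Ck_on_sub Uj (sk n).
Qed.

End Operations.

(** * Pullback along a holomorphic map, and its differential *)

Section Pullback.
Variables (X Y : riemannSurface R) (f : Y -> X).
Hypothesis hf : holomorphic_map f.

Lemma pullback_holomorphic (L : line_bundle R X) :
  holomorphic_line_bundle L ->
  holomorphic_line_bundle (pullback f L : line_bundle R Y).
Proof.
move=> [oL cL hL nL iL kL]; split=> /=.
- by move=> i; apply: preimage_open => //; exact: hf.1.
- by move=> y; exact: cL.
- by move=> i j; apply: (holomorphic_fun_pullback hf) (hL i j); exact: openI.
- by move=> i j y; exact: nL.
- by move=> i y; exact: iL.
- by move=> i j k y; exact: kL.
Qed.

Lemma pullback_hermitian (L : line_bundle R X) (h : metric L) :
  (forall i : lb_idx L, open (lb_dom i)) ->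
  hermitian_metric h -> @hermitian_metric _ Y _ (pullback_metric f h).
Proof.
move=> oL [sh ph th]; split=> /=.
- by move=> i; exact: (smooth_fun_pullback hf (oL i) (sh i)).
- by move=> i y; exact: ph.
- by move=> i j y; exact: th.
Qed.

Lemma pullback_holomorphic_section (L : line_bundle R X) (s : lsection L) :
  (forall i : lb_idx L, open (lb_dom i)) ->
  holomorphic_section s -> @holomorphic_section _ Y _ (pullback_section f s).
Proof.
move=> oL [hs ts]; split=> /=.
- by move=> i; exact: (holomorphic_fun_pullback hf (oL i) (hs i)).
- by move=> i j y; exact: ts.
Qed.

(** The factor |F'|^2 is the Jacobian of f written in the charts a and b, by which a coefficient on
    dx /\ dy is multiplied under pullback. *)
Lemma pullback_curvature (L : line_bundle R X) (h : metric L) (i : lb_idx L)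
    (a : rs_idx Y) (b : rs_idx X) (y : Y) :
  (forall i : lb_idx L, open (lb_dom i)) -> hermitian_metric h ->
  lb_dom i (f y) -> cdom (rs_chart a) y -> cdom (rs_chart b) (f y) ->
  @curvature _ Y _ (pullback_metric f h) i a y =
    (sqmod (dz (zcoord (rs_chart b) \o f \o cinv (rs_chart a))
       (zcoord (rs_chart a) y)))%:C * curvature h i b (f y).
Proof.
move=> oL hh iy ay fy; have [ph sh] := metric_chart i b hh.
pose U := in_chart (rs_chart a) (f @^-1` (lb_dom i `&` cdom (rs_chart b))).
have oU : open U.
  apply: in_chart_open; apply: preimage_open; first exact: hf.1.
  by apply: openI => //; exact: cdom_open.
have Uy : U (zcoord (rs_chart a) y) by exact: in_chart_zcoord.
have hF : holomorphic_on U (zcoord (rs_chart b) \o f \o cinv (rs_chart a)).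
  by apply: hol_sub (hf.2 a b); apply: in_chartS => w [].
have FUV w : U w -> in_chart (rs_chart b) (lb_dom i)
    ((zcoord (rs_chart b) \o f \o cinv (rs_chart a)) w).
  by move=> [aw [iw bw]]; exact: in_chart_zcoord.
have := chern_curvature_comp oU (in_chart_open _ (oL i)) FUV Uy hF ph sh.
rewrite {2}/comp /= (zcoordK (mem_set ay)) => <-.
(* Passing through the chart b is the identity only where f lands in its domain, so the two local
   expressions of the metric agree on U. *)
have E w : U w -> (h i \o cinv (rs_chart b) \o
    (zcoord (rs_chart b) \o f \o cinv (rs_chart a))) w =
    (pullback_metric f h i \o cinv (rs_chart a)) w.
  by move=> [aw [iw bw]]; rewrite /= zcoordK// inE.
have skF := fun n => Ck_on_comp oU (in_chart_open _ (oL i)) FUV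
  (hol_Re hF n) (hol_Im hF n) (sh n).
have pF w : U w -> 0 < (h i \o cinv (rs_chart b) \o
    (zcoord (rs_chart b) \o f \o cinv (rs_chart a))) w by move=> /FUV/ph.
exact/esym/(eq_chern_curvature oU Uy pF skF E).
Qed.

Lemma differential_holomorphic : holomorphic_section (differential f).
Proof.
split.
- move=> [a b] /=.
  apply: (@holomorphic_fun_chart Y a (f @^-1` cdom (rs_chart b))
    (dz (zcoord (rs_chart b) \o f \o cinv (rs_chart a)))).
    by apply: preimage_open; [exact: hf.1|exact: cdom_open].
  apply: hol_dz; last exact: hf.2.
  apply: in_chart_open; apply: preimage_open; [exact: hf.1|exact: cdom_open].
- move=> [a b] [a' b'] y [/= ay fby] [/= a'y fb'y]; rewrite /differential /=.
  pose T := zcoord (rs_chart a') \o cinv (rs_chart a).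
  pose F := zcoord (rs_chart b') \o f \o cinv (rs_chart a').
  pose S := zcoord (rs_chart b) \o cinv (rs_chart b').
  pose D := cdom (rs_chart a') `&`
    f @^-1` (cdom (rs_chart b) `&` cdom (rs_chart b')).
  have oD : open D.
    apply: openI; first exact: cdom_open.
    by apply: preimage_open; [exact: hf.1|apply: openI; exact: cdom_open].
  have oU := in_chart_open (rs_chart a) oD.
  have Dy : D y by [].
  have Uy := in_chart_zcoord ay Dy.
  have oV := in_chart_open (rs_chart a') oD.
  have Vy := in_chart_zcoord a'y Dy.
  have oW := in_chart_open (rs_chart b') (@cdom_open _ _ (rs_chart b)).
  have hT : holomorphic_on (in_chart (rs_chart a) D) T.
    by apply: hol_sub (rs_compat a' a); apply: in_chartS => w [].
  have hF : holomorphic_on (in_chart (rs_chart a') D) F.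
    by apply: hol_sub (hf.2 a' b'); apply: in_chartS => w [? []].
  have hS : holomorphic_on (in_chart (rs_chart b') (cdom (rs_chart b))) S.
    exact: rs_compat.
  have TUV w : in_chart (rs_chart a) D w -> in_chart (rs_chart a') D (T w).
    by move=> [aw Dw]; apply: in_chart_zcoord => //; case: Dw.
  have FVW w : in_chart (rs_chart a') D w ->
      in_chart (rs_chart b') (cdom (rs_chart b)) (F w).
    by move=> [aw [? []]] bw b'w; exact: in_chart_zcoord.
  have Ty : T (zcoord (rs_chart a) y) = zcoord (rs_chart a') y.
    by rewrite /T /= zcoordK// inE.
  have Fy : F (zcoord (rs_chart a') y) = zcoord (rs_chart b') (f y).
    by rewrite /F /= zcoordK// inE.
  (* In the charts a and b the map is F between the changes of coordinates T on Y and S on X; the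
     transition rule is then the chain rule. *)
  transitivity (dz (S \o F \o T) (zcoord (rs_chart a) y)).
    apply: (eq_dz oU Uy) => w [aw [a'w [bw b'w]]].
    by rewrite /S /F /T /= !zcoordK// inE.
  have hSF := hol_comp oV oW FVW hF hS.
  rewrite (dz_comp oU oV Uy _ hT hSF); last exact: TUV.
  rewrite Ty (dz_comp oV oW Vy _ hF hS) ?Fy; last by rewrite -Fy; exact: FVW.
  (* The chain rule yields dz_a'/dz_a, while the cotangent transition is defined as the inverse of
     dz_a/dz_a'; the cocycle identity identifies them. *)
  have h := @tangent_cocycle Y a a' a y ay a'y ay.
  rewrite tangent_id//= -/T in h.
  have B0 := hlb_neq0 (tangent_holomorphic Y) ay a'y.
  have -> : dz T (zcoord (rs_chart a) y) =
      (@lb_trans _ _ (tangent Y) a a' y)^-1.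
    by apply: (mulfI B0); rewrite mulfV.
  by rewrite mulrC mulrA.
Qed.

End Pullback.
End Bundles.

(** * The vortex equation on Y *)

Theorem proposition6p1 (R : realType) (X Y : riemannSurface R)
  (gX : metric (tangent X)) (gY : metric (tangent Y))
  (tau : R) (f : Y -> X)
  (L' : line_bundle R X) (h' : metric L') (phi' : lsection L') :
  kahler_metric gX -> kahler_metric gY ->
  0 < tau ->
  holomorphic_map f ->
  is_gauss_curvature gY (fun=> - (tau / 2)) ->
  is_gauss_curvature gX (fun=> - (tau / 2)) ->
  vortex gX (1 / 2) tau h' phi' ->
  let L := tensor (tensor (cotangent Y) (pullback f (tangent X)))
                  (pullback f L') in
  let h : metric L :=
    tensor_metric (tensor_metric (dual_metric gY) (pullback_metric f gX))
                  (pullback_metric f h') in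
  let phi : lsection L :=
    tensor_section (differential f) (pullback_section f phi') in
  vortex gY (1 / 2) tau h phi.
Proof.
move=> kX kY tau0 hf cY cX [bL' mL' sL' eL'] L h phi.
have bY := tangent_holomorphic Y; have bX := tangent_holomorphic X.
have bdY := dual_holomorphic bY.
have bfX := pullback_holomorphic hf bX; have bfL := pullback_holomorphic hf bL'.
have bT := tensor_holomorphic bdY bfX.
have mdY := dual_hermitian (hlb_open bY) kY.
have mfX := pullback_hermitian hf (hlb_open bX) kX.
have mfL := pullback_hermitian hf (hlb_open bL') mL'.
have mT := tensor_hermitian (hlb_open bdY) (hlb_open bfX) mdY mfX.
split.
- exact: tensor_holomorphic.
- exact: tensor_hermitian (hlb_open bT) (hlb_open bfL) mT mfL.
- exact: (tensor_holomorphic_section (hlb_open bT) (hlb_open bfL)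
    (differential_holomorphic hf)
    (pullback_holomorphic_section hf (hlb_open bL') sL')).
(* The chart a' gives the frame of T^*Y, while the forms are read in a possibly different chart a.
   The index b is a frame of TX and also a chart around f y, so it serves for the forms on X too. *)
move=> [[a' b] j] a y [/= [a'y bfy] jfy] ay.
rewrite (tensor_curvature (hlb_open bT) (hlb_open bfL) mT mfL)//.
rewrite (tensor_curvature (hlb_open bdY) (hlb_open bfX) mdY mfX)//.
rewrite (dual_curvature (hlb_open bY) kY)//.
rewrite (pullback_curvature hf (hlb_open bX) kX bfy ay bfy).
rewrite (pullback_curvature hf (hlb_open bL') mL' jfy ay bfy).
rewrite (cY a' a y a'y ay) (cX b b (f y) bfy bfy).
have /subr0_eq -> := eL' j b (f y) jfy bfy.
(* Both |df|^2 and g_Y scale by |dz_a/dz_a'|^2 between the charts a and a'. *)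
pose B := @lb_trans _ _ (tangent Y) a a' y.
have B0 : B != 0 := hlb_neq0 bY ay a'y.
have dfE : differential f (a, b) y = B^-1 * differential f (a', b) y.
  rewrite (sec_trans (differential_holomorphic hf) (i := (a, b))
    (j := (a', b)) (x := y) (conj ay bfy) (conj a'y bfy)).
  congr (_ * _); rewrite -[RHS]mulr1; congr (_ * _); exact: tangent_id.
have gYE : gY a' y = sqmod B * gY a y := met_trans kY ay a'y.
have gY0 : gY a y != 0 by rewrite gt_eqF// (met_gt0 kY).
have sB0 : sqmod B != 0 by rewrite sqmod_eq0.
clearbody B; rewrite -[dz _ _]/(differential f (a, b) y) dfE.
rewrite /sqnorm -[phi _ y]/(differential f (a', b) y * phi' j (f y))
  -[h _ y]/((gY a' y)^-1 * gX b (f y) * h' j (f y)) /vol gYE.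
move: (differential f (a', b) y) => D; rewrite !sqmodM sqmodV.
move: (sqmod B) (sqmod D) (sqmod (phi' j (f y))) sB0 gY0 => sB sD sphi.
move: (gY a y) (gX b (f y)) (h' j (f y)) (Complex 0 1 : cplx R) => GY GX H i.
move=> sB0 GY0.
have sBC : (sB%:C : cplx R) != 0 by rewrite fmorph_eq0.
have GYC : (GY%:C : cplx R) != 0 by rewrite fmorph_eq0.
(* Only g_Y and the squared modulus of the coordinate change occur as denominators; the norms of df
   and phi' stay in numerators and may vanish. *)
by field; apply/andP.
Qed.
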